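(* Let $E:\mathcal{H}\to\mathbb{R}$ be of class $C^2$ and let $P_*\in\mathcal{M}_N$ be a nondegenerate local minimizer of $E$ on $\mathcal{M}_N$, i.e. there exists $\eta>0$ such that $E(P)\ge E(P_* )+\eta\|P-P_*\|_{\rm F}^2$ for all $P\in\mathcal{M}_N$ in a neighborhood of $P_*$. Let $R:\mathcal{H}\to\mathcal{H}$ be of class $C^2$ such that for all $P\in\mathcal{M}_N$ and all $X\in\mathcal{H}$ small enough, $R(P+X)\in\mathcal{M}_N$ and $R(P+X)=P+\Pi_P(X)+O(X^2)$. Assume that $P_*$ satisfies the strong Aufbau principle: $\Phi(P_* )=P_*$ and $\nu:=\varepsilon_{N+1}-\varepsilon_N>0$, where $\varepsilon_1\le\cdots\le\varepsilon_{N_b}$ are the eigenvalues of $H_*$. Then for $\beta>0$ small enough and $P^0\in\mathcal{M}_N$ close enough to $P_*$, the iterates \[ P^{k+1}:=R\big(P^k+\beta\,\Pi_{P^k}(\Phi(P^k)-P^k)\big) \] are well defined and converge linearly to $P_*$ with asymptotic rate $r(1-\beta J_{\rm SCF})<1$, where $J_{\rm SCF}:=1+\Omega_*^{-1}K_*$; that is, for every $\theta>0$ there is $C_\theta>0$ such that $\|P^k-P_*\|_{\rm F}\le C_\theta\,(r(1-\beta J_{\rm SCF})+\theta)^k\,\|P^0-P_*\|_{\rm F}$ for all $k$, for all such $P^0$.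
   Context: $\mathcal{H}$ is the space of real symmetric $N_b\times N_b$ matrices with the Frobenius inner product $\mathrm{Tr}(AB)$. For $1\le N\le N_b$, $\mathcal{M}_N:=\{P\in\mathcal{H}\mid P^2=P,\ \mathrm{Tr}(P)=N\}$. For $P\in\mathcal{M}_N$, $\Pi_P(X)=PX(1-P)+(1-P)XP$ is the orthogonal projection onto the tangent space $T_P\mathcal{M}_N=\{X\in\mathcal{H}\mid PXP=(1-P)X(1-P)=0\}$. Write $H(P):=\nabla E(P)$, $H_*:=H(P_* )$, $K_*:=\Pi_{P_*}\nabla^2E(P_* )\Pi_{P_*}$, and $\Omega_*:T_{P_*}\mathcal{M}_N\to T_{P_*}\mathcal{M}_N$, $\Omega_*X:=-[P_*,[H_*,X]]$ (equivalently $P_*X(1-P_* )H_*-H_*P_*X(1-P_* )$ plus its transpose); under the stated gap assumption $\Omega_*$ is invertible on $T_{P_*}\mathcal{M}_N$. For a symmetric matrix $P$ such that the $N$-th and $(N+1)$-st smallest eigenvalues of $H(P)$ are distinct, $\Phi(P):=\sum_{i=1}^N\phi_i\phi_i^*$ where $\phi_1,\dots,\phi_N$ are orthonormal eigenvectors of $H(P)$ associated with its $N$ lowest eigenvalues. $J_{\rm SCF}$ acts on $T_{P_*}\mathcal{M}_N$ and $r(\cdot)$ is the spectral radius. *)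

(* Defs.v *)
From HB Require Import structures.
From mathcomp Require Import all_boot all_order all_algebra.
From mathcomp Require Import all_classical all_reals.
From mathcomp Require Import topology normedtype derive.
Set Implicit Arguments. Unset Strict Implicit. Unset Printing Implicit Defensive.
Import Order.TTheory GRing.Theory Num.Theory.
Import numFieldNormedType.Exports.
Local Open Scope classical_set_scope.
Local Open Scope ring_scope.

Section Defs.
Variable R : realType.
Variable n : nat.
Notation M := 'M[R]_n.

(* C^1: differentiable everywhere with continuous differential (finite dim:
   continuity of x |-> 'd f x v for every direction v). *)
Definition C1 (V W : normedModType R) (f : V -> W) : Prop :=
  (forall x, differentiable f x) /\ (forall v : V, continuous (fun x => 'd f x v)).
Definition C2 (V W : normedModType R) (f : V -> W) : Prop :=
  C1 f /\ (forall v : V, C1 (fun x => 'd f x v)).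

Definition symmH (X : M) : Prop := X^T = X.
Definition frob (X : M) : R := Num.sqrt (\tr (X^T *m X)).
Definition grassmann (N : nat) (P : M) : Prop :=
  symmH P /\ P *m P = P /\ \tr P = N%:R.

(* orthogonal projection onto the tangent space T_P M_N *)
Definition PiP (P X : M) : M := P *m X *m (1 - P) + (1 - P) *m X *m P.
Definition tangent (P : M) : set M :=
  [set X | symmH X /\ P *m X *m P = 0 /\ (1 - P) *m X *m (1 - P) = 0].

(* E is given on all of 'M_n; its gradient on the space H of symmH
   matrices is the symmH part of the full gradient. *)
Definition gradE (E : M -> R) (P : M) : M :=
  \matrix_(i, j) (('d E P (delta_mx i j) + 'd E P (delta_mx j i)) / 2).
Definition hessE (E : M -> R) (P X : M) : M := 'd (gradE E) P X.

Definition spec_decomp (Hm U : M) (d : 'I_n -> R) : Prop :=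
  U^T *m U = 1 /\ (forall i j : 'I_n, (i <= j)%N -> d i <= d j) /\
  Hm = U *m diag_mx (\row_i d i) *m U^T.
(* gap between the N-th and (N+1)-st smallest eigenvalues (1-based) *)
Definition gap_at (N : nat) (d : 'I_n -> R) : Prop :=
  exists i j : 'I_n, (i : nat) = N.-1 /\ (j : nat) = N /\ d i < d j.
Definition has_gap (N : nat) (Hm : M) : Prop :=
  exists U d, spec_decomp Hm U d /\ gap_at N d.
Definition aufbau_proj (N : nat) (Hm Q : M) : Prop :=
  exists U d, spec_decomp Hm U d /\ gap_at N d /\
    Q = \sum_(i < n | (i < N)%N) (col i U *m (col i U)^T).
Definition Phi (N : nat) (E : M -> R) (P : M) : M :=
  xget 0 [set Q | aufbau_proj N (gradE E P) Q].

Definition Omega (E : M -> R) (Ps X : M) : M :=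
  let Hs := gradE E Ps in
  - (Ps *m (Hs *m X - X *m Hs) - (Hs *m X - X *m Hs) *m Ps).
Definition Omega_inv (E : M -> R) (Ps Y : M) : M :=
  xget 0 [set Z | tangent Ps Z /\ Omega E Ps Z = Y].
Definition Kop (E : M -> R) (Ps X : M) : M := PiP Ps (hessE E Ps (PiP Ps X)).
Definition Jscf (E : M -> R) (Ps X : M) : M := X + Omega_inv E Ps (Kop E Ps X).

(* complex eigenvalue a + i b of a real linear operator L on a real
   subspace T (eigenvector X + iY of the complexification) *)
Definition eigen_on (T : set M) (L : M -> M) (a b : R) : Prop :=
  exists X Y : M, T X /\ T Y /\ (X != 0 \/ Y != 0) /\
    L X = a *: X - b *: Y /\ L Y = b *: X + a *: Y.
Definition specrad_on (T : set M) (L : M -> M) : R :=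
  sup [set r : R | exists a b : R, eigen_on T L a b /\ r = Num.sqrt (a ^+ 2 + b ^+ 2)].

Fixpoint scf_iter (N : nat) (E : M -> R) (Rt : M -> M) (beta : R) (P0 : M)
    (k : nat) : M :=
  match k with
  | 0 => P0
  | k'.+1 => let P := scf_iter N E Rt beta P0 k' in
             Rt (P + beta *: PiP P (Phi N E P - P))
  end.

End Defs.

(* Main.v *)
Require Import Defs.
From HB Require Import structures.
From mathcomp Require Import all_boot all_order all_algebra.
From mathcomp Require Import perm.
From mathcomp Require Import all_classical all_reals.
From mathcomp Require Import topology normedtype landau derive sequences.
From mathcomp Require Import ring lra.
Set Implicit Arguments. Unset Strict Implicit. Unset Printing Implicit Defensive.
Import Order.TTheory GRing.Theory Num.Theory.
Import numFieldNormedType.Exports.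
Local Open Scope classical_set_scope.
Local Open Scope ring_scope.

(** Write Q for the minimiser, H for the gradient of E at Q and T for the tangent space at
    Q. The gap makes <X, Y> = Tr (X Omega Y) an inner product on T, for which
    J = Omega^-1 (Omega + K) is self-adjoint and, by the second order optimality condition,
    positive. For small beta the norm of 1 - beta J is therefore its largest eigenvalue,
    so it equals the spectral radius rho < 1; no genuinely complex eigenvalue occurs, and
    an extremal eigenvector is found by minimising a Rayleigh quotient.

    Ky Fan's minimum principle with a gap, (nu / 2) |P - Q|^2 <= Tr (H P) - Tr (H Q) for
    all P in the manifold, gives at once the stability of the spectral projector under
    perturbations of H, the persistence of the gap, and (in the limit P -> Q) the
    positivity of Omega. Since Phi(P) commutes with the gradient at P, linearising the
    commutation relation yields Phi(P) - Q = - Omega^-1 K (P - Q) + o(P - Q), so that one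
    SCF step acts on P - Q as 1 - beta J up to o(P - Q). *)

(** * The Frobenius inner product *)

(** In the code the minimiser is [P], finally [Ps], and [Q] is a nearby point of the manifold. Two
    obstacles shape the argument. The inequalities on E and on Tr (H Q) hold on the manifold, while
    the linear theory needs quadratic forms on tangent vectors. Since H commutes with P, Tr (H (Q -
    P)) is exactly a quadratic form in the chord Q - P. Each inequality is put in this form, and
    curves supplied by the retraction carry it to the tangent space. Moreover, chords are not
    tangent, and J is in general not symmetric for the Frobenius product, so a Frobenius estimate of
    one step would not show the rate rho. Errors are therefore measured by the Omega norm of the
    tangential part plus the Frobenius norm of the normal part, which is of second order. In this
    norm a step contracts by rho + e with no constant in front, and the equivalence with the
    Frobenius norm enters only once, in the final constant. *)

Section PositiveForm.
Context {R : realType} {V : lmodType R}.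
Variables (T : set V) (b : V -> V -> R).
Hypothesis Tlin : forall a x y, T x -> T y -> T (a *: x + y).
Hypothesis b_linearl : forall a x y z, b (a *: x + y) z = a * b x z + b y z.
Hypothesis b_sym : forall x y, T x -> T y -> b x y = b y x.
Hypothesis b_ge0 : forall x, T x -> 0 <= b x x.

Lemma psd_expand a c x y : T x -> T y ->
  b (a *: x + c *: y) (a *: x + c *: y) =
  a ^+ 2 * b x x + 2 * a * c * b x y + c ^+ 2 * b y y.
Proof.
move=> Tx Ty.
have T0 : T 0 by have := Tlin (-1) Tx Tx; rewrite scaleN1r addNr.
have Tcy : T (c *: y) by have := Tlin c Ty T0; rewrite addr0.
have Tz : T (a *: x + c *: y) by exact: Tlin.
have b0 z : b 0 z = 0.
  by have := b_linearl (-1) 0 0 z; rewrite scaler0 addr0 mulN1r addNr.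
have bz z : b (c *: y) z = c * b y z.
  by have := b_linearl c y 0 z; rewrite addr0 b0 addr0.
rewrite b_linearl bz (b_sym Tx Tz) (b_sym Ty Tz) !b_linearl !bz (b_sym Ty Tx).
by ring.
Qed.

(** The form may be degenerate. If [b y y] is nonzero, nonnegativity at [b y y *: x - b x y *: y]
    gives the claim, and symmetrically for [x]. If both squares vanish, nonnegativity at [x + y] and
    [x - y] forces [b x y = 0]. *)
Lemma psd_CauchySchwarz x y : T x -> T y -> b x y ^+ 2 <= b x x * b y y.
Proof.
move=> Tx Ty.
have T0 : T 0 by have := Tlin (-1) Tx Tx; rewrite scaleN1r addNr.
have Tz a c : T (a *: x + c *: y).
  by apply: Tlin => //; have := Tlin c Ty T0; rewrite addr0.
have pos a c : 0 <= a ^+ 2 * b x x + 2 * a * c * b x y + c ^+ 2 * b y y.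
  by rewrite -psd_expand //; exact/b_ge0/Tz.
have bx := b_ge0 Tx; have by_ := b_ge0 Ty.
have [y0|y0] := eqVneq (b y y) 0; last first.
  have {}y0 : 0 < b y y by rewrite lt_def y0.
  rewrite -(ler_pM2l y0).
  by have := pos (b y y) (- b x y); nra.
have [x0|x0] := eqVneq (b x x) 0; last first.
  have {}x0 : 0 < b x x by rewrite lt_def x0.
  rewrite -(ler_pM2l x0).
  by have := pos (- b x y) (b x x); nra.
have := pos 1 1; have := pos 1 (-1); rewrite x0 y0 => h1 h2.
by have -> : b x y = 0 by lra.
Qed.

Lemma psd_minkowski x y : T x -> T y ->
  Num.sqrt (b (x + y) (x + y)) <= Num.sqrt (b x x) + Num.sqrt (b y y).
Proof.
move=> Tx Ty; have := psd_expand 1 1 Tx Ty; rewrite !scale1r !expr1n !mul1r mulr1 => bxy.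
have Txy : T (x + y) by rewrite -(scale1r x); exact: Tlin.
have sq z : T z -> Num.sqrt (b z z) ^+ 2 = b z z by move=> Tz; rewrite sqr_sqrtr ?b_ge0.
rewrite -ler_sqr ?nnegrE ?addr_ge0 ?sqrtr_ge0 // sqrrD !sq // bxy.
have : b x y <= Num.sqrt (b x x) * Num.sqrt (b y y).
  rewrite -sqrtrM ?b_ge0 // (le_trans (ler_norm _)) // -sqrtr_sqr.
  by rewrite ler_sqrt ?psd_CauchySchwarz // mulr_ge0 ?b_ge0.
by lra.
Qed.

End PositiveForm.

Section Frobenius.
Context {R : realType}.

Definition ip m n (A B : 'M[R]_(m, n)) : R := \tr (A^T *m B).

Lemma ipE m n (A B : 'M[R]_(m, n)) : ip A B = \sum_i \sum_j A i j * B i j.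
Proof.
rewrite exchange_big; apply: eq_bigr => i _.
by rewrite !mxE; apply: eq_bigr => j _; rewrite !mxE.
Qed.

Lemma ipC m n (A B : 'M[R]_(m, n)) : ip A B = ip B A.
Proof. by rewrite /ip -mxtrace_tr trmx_mul trmxK. Qed.

Lemma ipDl m n (A B C : 'M[R]_(m, n)) : ip (A + B) C = ip A C + ip B C.
Proof. by rewrite /ip linearD mulmxDl linearD. Qed.

Lemma ipZl m n a (A C : 'M[R]_(m, n)) : ip (a *: A) C = a * ip A C.
Proof. by rewrite /ip linearZ -scalemxAl linearZ. Qed.

Lemma ipNl m n (A C : 'M[R]_(m, n)) : ip (- A) C = - ip A C.
Proof. by rewrite -scaleN1r ipZl mulN1r. Qed.

Lemma ipBl m n (A B C : 'M[R]_(m, n)) : ip (A - B) C = ip A C - ip B C.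
Proof. by rewrite ipDl ipNl. Qed.

Lemma ipDr m n (A B C : 'M[R]_(m, n)) : ip C (A + B) = ip C A + ip C B.
Proof. by rewrite ipC ipDl !(ipC _ C). Qed.

Lemma ipZr m n a (A C : 'M[R]_(m, n)) : ip C (a *: A) = a * ip C A.
Proof. by rewrite ipC ipZl ipC. Qed.

Lemma ipNr m n (A C : 'M[R]_(m, n)) : ip C (- A) = - ip C A.
Proof. by rewrite ipC ipNl ipC. Qed.

Lemma ipBr m n (A B C : 'M[R]_(m, n)) : ip C (A - B) = ip C A - ip C B.
Proof. by rewrite ipDr ipNr. Qed.

Lemma ip0l m n (A : 'M[R]_(m, n)) : ip 0 A = 0.
Proof. by rewrite -(scale0r A) ipZl mul0r. Qed.

Lemma ip0r m n (A : 'M[R]_(m, n)) : ip A 0 = 0.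
Proof. by rewrite ipC ip0l. Qed.

Lemma ip_ge0 m n (A : 'M[R]_(m, n)) : 0 <= ip A A.
Proof.
by rewrite ipE sumr_ge0 // => i _; rewrite sumr_ge0 // => j _; rewrite -expr2 sqr_ge0.
Qed.

Lemma le_entry_ip m n (A : 'M[R]_(m, n)) i j : A i j ^+ 2 <= ip A A.
Proof.
rewrite ipE (bigD1 i) //= (bigD1 j) //= expr2 -addrA lerDl addr_ge0 //.
  by rewrite sumr_ge0 // => k _; rewrite -expr2 sqr_ge0.
by rewrite sumr_ge0 // => k _; rewrite sumr_ge0 // => l _; rewrite -expr2 sqr_ge0.
Qed.

Lemma ip_eq0 m n (A : 'M[R]_(m, n)) : ip A A = 0 -> A = 0.
Proof.
move=> A0; apply/matrixP => i j; rewrite mxE; apply/eqP.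
by rewrite -sqrf_eq0 eq_le sqr_ge0 -A0 le_entry_ip.
Qed.

Lemma ip_gt0 m n (A : 'M[R]_(m, n)) : A != 0 -> 0 < ip A A.
Proof.
move=> A0; rewrite lt_def ip_ge0 andbT.
by apply: contra A0 => /eqP/ip_eq0 ->.
Qed.

Lemma ip_CauchySchwarz m n (A B : 'M[R]_(m, n)) : ip A B ^+ 2 <= ip A A * ip B B.
Proof.
apply: (@psd_CauchySchwarz _ _ setT) => //.
- by move=> a x y z; rewrite ipDl ipZl.
- by move=> x y _ _; exact: ipC.
- by move=> x _; exact: ip_ge0.
Qed.

Lemma ip_mulmxl m n p (A : 'M[R]_(m, n)) (B : 'M_(n, p)) (C : 'M_(m, p)) :
  ip (A *m B) C = ip B (A^T *m C).
Proof. by rewrite /ip trmx_mul mulmxA. Qed.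

Lemma ip_mulmxr m n p (A : 'M[R]_(m, n)) (B : 'M_(n, p)) (C : 'M_(m, p)) :
  ip (A *m B) C = ip A (C *m B^T).
Proof. by rewrite /ip trmx_mul -mulmxA mxtrace_mulC mulmxA. Qed.

Lemma ip_trmx m n (A B : 'M[R]_(m, n)) : ip A^T B^T = ip A B.
Proof. by rewrite /ip trmxK mxtrace_mulC -mxtrace_tr trmx_mul !trmxK. Qed.

Lemma ip_mulmx_le m n p (A : 'M[R]_(m, n)) (B : 'M_(n, p)) :
  ip (A *m B) (A *m B) <= ip A A * ip B B.
Proof.
have -> : ip A A * ip B B = \sum_i \sum_j
    (\sum_k A i k ^+ 2) * (\sum_k B k j ^+ 2).
  rewrite (ipE A) -(ip_trmx B) (ipE B^T) mulr_suml; apply: eq_bigr => i _.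
  rewrite mulr_sumr; apply: eq_bigr => j _.
  by congr (_ * _); apply: eq_bigr => k _; rewrite ?mxE expr2.
rewrite ipE; apply: ler_sum => i _; apply: ler_sum => j _.
have := ip_CauchySchwarz (\row_k A i k) (\row_k B k j).
rewrite !ipE !big_ord1 -expr2 !mxE.
under eq_bigr do rewrite !mxE; under [X in _ <= X * _]eq_bigr do rewrite !mxE.
under [X in _ <= _ * X]eq_bigr do rewrite !mxE.
by [].
Qed.

Definition fnorm m n (A : 'M[R]_(m, n)) : R := Num.sqrt (ip A A).

Lemma fnorm_ge0 m n (A : 'M[R]_(m, n)) : 0 <= fnorm A.
Proof. exact: sqrtr_ge0. Qed.
Hint Resolve fnorm_ge0 : core.

Lemma fnorm_sqr m n (A : 'M[R]_(m, n)) : fnorm A ^+ 2 = ip A A.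
Proof. by rewrite sqr_sqrtr // ip_ge0. Qed.

Lemma fnorm0 m n : fnorm (0 : 'M[R]_(m, n)) = 0.
Proof. by rewrite /fnorm ip0l sqrtr0. Qed.

Lemma fnorm_eq0 m n (A : 'M[R]_(m, n)) : fnorm A = 0 -> A = 0.
Proof. by move=> A0; apply: ip_eq0; rewrite -fnorm_sqr A0 expr0n. Qed.

Lemma fnormZ m n a (A : 'M[R]_(m, n)) : fnorm (a *: A) = `|a| * fnorm A.
Proof. by rewrite /fnorm ipZl ipZr mulrA -expr2 sqrtrM ?sqr_ge0 // sqrtr_sqr. Qed.

Lemma fnormN m n (A : 'M[R]_(m, n)) : fnorm (- A) = fnorm A.
Proof. by rewrite -scaleN1r fnormZ normrN1 mul1r. Qed.

Lemma fnormC m n (A B : 'M[R]_(m, n)) : fnorm (A - B) = fnorm (B - A).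
Proof. by rewrite -fnormN opprB. Qed.

Lemma fnorm_tr m n (A : 'M[R]_(m, n)) : fnorm A^T = fnorm A.
Proof. by rewrite /fnorm ip_trmx. Qed.

Lemma ler_ip m n (A B : 'M[R]_(m, n)) : `|ip A B| <= fnorm A * fnorm B.
Proof.
rewrite -ler_sqr ?nnegrE ?mulr_ge0 //.
by rewrite real_normK ?num_real // exprMn !fnorm_sqr ip_CauchySchwarz.
Qed.

Lemma fnormD m n (A B : 'M[R]_(m, n)) : fnorm (A + B) <= fnorm A + fnorm B.
Proof.
rewrite -ler_sqr ?nnegrE ?addr_ge0 // fnorm_sqr ipDl !ipDr (ipC B A) sqrrD !fnorm_sqr.
have := le_trans (ler_norm _) (ler_ip A B); lra.
Qed.

Lemma fnormB m n (A B : 'M[R]_(m, n)) : fnorm (A - B) <= fnorm A + fnorm B.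
Proof. by rewrite -(fnormN B) fnormD. Qed.

Lemma fnormM m n p (A : 'M[R]_(m, n)) (B : 'M_(n, p)) :
  fnorm (A *m B) <= fnorm A * fnorm B.
Proof.
by rewrite -ler_sqr ?nnegrE ?mulr_ge0 // exprMn !fnorm_sqr ip_mulmx_le.
Qed.

Lemma fnorm_entry m n (A : 'M[R]_(m, n)) i j : `|A i j| <= fnorm A.
Proof.
by rewrite -ler_sqr ?nnegrE // real_normK ?num_real // fnorm_sqr le_entry_ip.
Qed.

Lemma fnorm_sum m n I (r : seq I) (F : I -> 'M[R]_(m, n)) :
  fnorm (\sum_(i <- r) F i) <= \sum_(i <- r) fnorm (F i).
Proof.
elim/big_ind2: _ => [|A a B b hA hB|//]; first by rewrite fnorm0.
by rewrite (le_trans (fnormD _ _)) // lerD.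
Qed.

(** The topology and the differentials on matrices come from the max norm. This bound and
    [fnorm_le_mx_norm] translate to the Frobenius norm, in which all estimates are made. *)
Lemma mx_norm_le_fnorm m n (A : 'M[R]_(m, n)) : `|A| <= fnorm A.
Proof.
rewrite /Num.norm/= mx_normrE; apply: bigmax_le => [|[i j] _] //=.
exact: fnorm_entry.
Qed.

Lemma fnorm_le_mx_norm m n (A : 'M[R]_(m, n)) : fnorm A <= (m * n)%:R * `|A|.
Proof.
rewrite [in leLHS](matrix_sum_delta A) pair_big /=.
apply: (le_trans (fnorm_sum _ _)).
have h (p : 'I_m * 'I_n) : fnorm (A p.1 p.2 *: delta_mx p.1 p.2 : 'M[R]_(m, n)) <= `|A|.
  rewrite fnormZ (_ : fnorm _ = 1) ?mulr1.
    by rewrite [leRHS]/Num.norm/= mx_normrE; apply: (@le_bigmax_cond _ _ _ _ p _ (fun i => `|A i.1 i.2|)).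
  rewrite /fnorm ipE (bigD1 p.1) //= (bigD1 p.2) //= !mxE !eqxx mulr1.
  rewrite !big1 ?addr0 ?sqrtr1 // => i ip; rewrite ?big1 // => *; rewrite !mxE.
    by rewrite (negbTE ip) mulr0.
  by rewrite (negbTE ip) andbF mulr0.
apply: (le_trans (ler_sum _ (fun p _ => h p))).
by rewrite sumr_const card_prod !card_ord mulr_natl.
Qed.

Lemma linear_fnorm_bound m n p q (f : {linear 'M[R]_(m, n) -> 'M[R]_(p, q)}) :
  exists2 C, 0 < C & forall X, fnorm (f X) <= C * fnorm X.
Proof.
(* The sum over the images of the basis matrices already bounds the map; adding 1 makes the constant
   positive. *)
exists (1 + \sum_i \sum_j fnorm (f (delta_mx i j))).
  rewrite ltr_wpDr ?ltr01 // sumr_ge0 // => i _; exact: sumr_ge0.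
move=> X; rewrite [in leLHS](matrix_sum_delta X) linear_sum.
apply: (le_trans (fnorm_sum _ _)); rewrite mulrDl mul1r.
apply: (@le_trans _ _ (\sum_i \sum_j fnorm (f (delta_mx i j)) * fnorm X)).
  apply: ler_sum => i _; rewrite linear_sum (le_trans (fnorm_sum _ _)) //.
  apply: ler_sum => j _; rewrite linearZ fnormZ mulrC ler_wpM2l //.
  exact: fnorm_entry.
rewrite mulr_suml; under eq_bigr do rewrite -mulr_suml.
by rewrite lerDr.
Qed.

End Frobenius.
#[global] Hint Extern 0 (is_true (0 <= fnorm _)) => exact: fnorm_ge0 : core.

Lemma frobE (R : realType) n (X : 'M[R]_n) : frob X = fnorm X.
Proof. by []. Qed.

(** * Minimisation of Rayleigh quotients *)

Section Compactness.
Context {R : realType}.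

Lemma linear_mx_continuous m n p q (f : {linear 'M[R]_(m, n) -> 'M[R]_(p, q)}) :
  continuous f.
Proof.
apply/linear_bounded_continuous/linear_boundedP.
have [C C0 fC] := linear_fnorm_bound f.
near=> r => x.
apply: (le_trans (mx_norm_le_fnorm _)); apply: (le_trans (fC x)).
apply: (@le_trans _ _ (C * (m * n)%:R * `|x|)).
  by rewrite -mulrA ler_wpM2l ?(ltW C0) ?fnorm_le_mx_norm.
by rewrite ler_wpM2r //; near: r; exact: nbhs_pinfty_ge.
Unshelve. all: by end_near. Qed.

Lemma ip_continuous m n p q (f g : {linear 'M[R]_(m, n) -> 'M[R]_(p, q)}) :
  continuous (fun X => ip (f X) (g X)).
Proof.
rewrite (_ : (fun X => _) = fun X => \sum_i \sum_j f X i j * g X i j); last first.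
  by apply/funext => X; exact: ipE.
have coord (k : {linear 'M[R]_(m, n) -> 'M[R]_(p, q)}) i j : continuous (fun X => k X i j).
  move=> X; apply: (@continuous_comp _ _ _ k (fun Y : 'M[R]_(p, q) => Y i j : R)).
    exact: linear_mx_continuous.
  exact: coord_continuous.
apply: continuous_big => [|i _]; first exact: add_continuous.
apply: continuous_big => [|j _ X]; first exact: add_continuous.
exact: (cvgM (coord f i j X) (coord g i j X)).
Qed.

(** Heine-Borel for row vectors, carried to matrices by the linear bijection [vec_mx], which
    preserves the Frobenius norm. *)
Lemma mx_bounded_closed_compact m n (A : set 'M[R]_(m, n)) c :
  (forall X, A X -> fnorm X <= c) -> closed A -> compact A.
Proof.
move=> Ac Acl.
have -> : A = vec_mx @` (vec_mx @^-1` A).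
  apply/seteqP; split=> [X AX|_ [v Av <-]] //.
  by exists (mxvec X); rewrite /preimage /= mxvecK.
apply: continuous_compact.
  exact/continuous_subspaceT/linear_mx_continuous.
apply: bounded_closed_compact.
  exists c; split; first exact: num_real.
  move=> M cM v /Ac Av; apply: (le_trans (mx_norm_le_fnorm _)).
  rewrite (le_trans _ (ltW cM)) //; apply: le_trans Av.
  rewrite -{1}(vec_mxK v) le_eqVlt; apply/orP; left; apply/eqP.
  rewrite /fnorm !ipE big_ord1; congr Num.sqrt.
  rewrite pair_big /= (reindex _ (curry_mxvec_bij _ _)) /=.
  by apply: eq_bigr => -[i j] _ /=; rewrite mxvecE.
by apply: preimage_closed => // v _; exact: linear_mx_continuous.
Qed.

(* The minimiser of the Rayleigh quotient is a generalised eigenvector because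
   the Cauchy-Schwarz inequality for the nonnegative form [g - l h], which
   vanishes at the minimiser, kills its pairing with every other vector. *)
Lemma rayleigh_min m n (T : set 'M[R]_(m, n))
    (g h : {linear 'M[R]_(m, n) -> 'M[R]_(m, n)}) c :
  (forall a x y, T x -> T y -> T (a *: x + y)) -> closed T ->
  (exists2 X, T X & X != 0) ->
  (forall x y, T x -> T y -> ip x (g y) = ip y (g x)) ->
  (forall x y, T x -> T y -> ip x (h y) = ip y (h x)) ->
  0 < c -> (forall x, T x -> c * ip x x <= ip x (h x)) ->
  exists X l, [/\ T X, X != 0, forall Y, T Y -> ip Y (g X) = l * ip Y (h X)
    & forall Y, T Y -> l * ip Y (h Y) <= ip Y (g Y)].
Proof.
move=> Tlin Tcl [X1 TX1 X10] gsym hsym c0 hc.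
have T0 : T 0 by have := Tlin (-1) _ _ TX1 TX1; rewrite scaleN1r addNr.
have TZ a x : T x -> T (a *: x) by move=> Tx; have := Tlin a _ _ Tx T0; rewrite addr0.
have hpos x : T x -> x != 0 -> 0 < ip x (h x).
  by move=> Tx x0; rewrite (lt_le_trans _ (hc _ Tx)) // mulr_gt0 // ip_gt0.
(* Normalisation is by [h] itself; coercivity of [h] makes this level set bounded, hence compact. *)
pose S := T `&` [set X | ip X (h X) = 1].
have normalise x : T x -> x != 0 -> S ((Num.sqrt (ip x (h x)))^-1 *: x).
  move=> Tx x0; split; first exact: TZ.
  rewrite /= linearZ ipZl ipZr mulrA -expr2 exprVn sqr_sqrtr ?ltW ?hpos //.
  by rewrite mulVf // gt_eqF // hpos.
have Scl : closed S.
  apply: closedI => //.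
  rewrite (_ : [set X | _] = (fun X => ip X (h X)) @^-1` [set 1]) //.
  apply: preimage_closed; last exact: closed_eq.
  by move=> X _; exact: (@ip_continuous _ _ _ _ idfun h X).
have Sb X : S X -> fnorm X <= Num.sqrt c^-1.
  move=> [TX hX]; rewrite ler_sqrt ?invr_ge0 ?(ltW c0) //.
  by rewrite -(ler_pM2l c0) mulfV ?gt_eqF // -hX hc.
have S0 : S !=set0 by eexists; exact: normalise TX1 X10.
have [|X0 /set_mem[TX0 hX0] minX0] := compact_EVT_min S0 (mx_bounded_closed_compact Sb Scl)
   (f := fun X => ip X (g X)).
  exact/continuous_subspaceT/(@ip_continuous _ _ _ _ idfun g).
set l := ip X0 (g X0) in minX0.
have lmin Y : T Y -> l * ip Y (h Y) <= ip Y (g Y).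
  move=> TY; have [->|Y0] := eqVneq Y 0; first by rewrite !ip0l mulr0.
  have /mem_set/minX0 /= := normalise _ TY Y0.
  rewrite linearZ ipZl ipZr mulrA -expr2 exprVn sqr_sqrtr ?(ltW (hpos _ TY Y0)) //.
  by rewrite ler_pdivlMl ?hpos // mulrC.
exists X0, l; split => //.
  by apply/eqP => X00; move: hX0; rewrite X00 /= ip0l => /esym/eqP; rewrite oner_eq0.
move=> Y TY.
pose b x y := ip x (g y) - l * ip x (h y).
suff : b Y X0 ^+ 2 <= 0.
  by rewrite le_eqVlt ltNge sqr_ge0 orbF sqrf_eq0 subr_eq0 => /eqP.
have bX0 : b X0 X0 = 0 by rewrite /b hX0 mulr1 subrr.
have -> : 0 = b Y Y * b X0 X0 by rewrite bX0 mulr0.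
apply: (@psd_CauchySchwarz _ _ T b) => //.
- by move=> a x y z; rewrite /b !ipDl !ipZl; ring.
- by move=> x y Tx Ty; rewrite /b gsym // hsym.
- by move=> x Tx; rewrite subr_ge0 lmin.
Qed.

End Compactness.

(** * Real spectral theorem *)

Section Spectral.
Context {R : realType}.

Lemma closed_linear_ker m n p q (f : {linear 'M[R]_(m, n) -> 'M[R]_(p, q)}) :
  closed [set X | f X = 0].
Proof.
rewrite (_ : [set X | _] = (fun X => ip (f X) (f X)) @^-1` [set 0]).
  by apply: preimage_closed; [move=> X _; exact: ip_continuous|exact: closed_eq].
by apply/seteqP; split=> X /= => [->|/ip_eq0 //]; rewrite ip0l.
Qed.

Lemma exists_orthogonal n k (A : 'M[R]_(k, n)) : (k < n)%N ->
  exists2 x : 'cV[R]_n, A *m x = 0 & x != 0.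
Proof.
move=> kn; exists (nz_row (kermx A^T))^T.
  apply/trmx_inj; rewrite trmx_mul trmxK trmx0; apply/sub_kermxP.
  exact: nz_row_sub.
rewrite -trmx0 (inj_eq trmx_inj) nz_row_eq0 kermx_eq0 /row_free.
by apply/eqP => rkA; have := rank_leq_col A^T; rewrite rkA leqNgt kn.
Qed.

(** The next eigenvector minimises the Rayleigh quotient on the orthogonal complement of those
    already found. The last clause records the minimality, which is what keeps the eigenvalues
    sorted when one more is appended. *)
Lemma spectral_partial n (H : 'M[R]_n) k : H^T = H -> (k <= n)%N ->
  exists (u : nat -> 'cV[R]_n) (d : nat -> R),
  [/\ forall i j, (i < k)%N -> (j < k)%N -> ip (u i) (u j) = (i == j)%:R,
      forall i, (i < k)%N -> H *m u i = d i *: u i,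
      forall i j, (i <= j)%N -> (j < k)%N -> d i <= d j &
      forall x i, (i < k)%N -> (forall j, (j < k)%N -> ip (u j) x = 0) ->
        d i * ip x x <= ip x (H *m x)].
Proof.
move=> Hs; elim: k => [_|k IH kn]; first by exists (fun=> 0), (fun=> 0).
have [u [d [ortho eig sorted bound]]] := IH (ltnW kn).
pose A : 'M[R]_(k, n) := \matrix_(i < k, j < n) u i j 0.
have AE x : A *m x = 0 <-> forall j, (j < k)%N -> ip (u j) x = 0.
  have AEj (j : 'I_k) : (A *m x) j 0 = ip (u j) x.
    rewrite mxE ipE; apply: eq_bigr => l _.
    by rewrite big_ord1 mxE.
  split=> [Ax j jk|ux]; first by rewrite -(AEj (Ordinal jk)) Ax mxE.
  by apply/colP => j; rewrite AEj ux // mxE.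
pose T : set 'cV[R]_n := [set x | A *m x = 0].
have Hsym x y : ip x (H *m y) = ip y (H *m x) :> R.
  by rewrite ipC ip_mulmxl Hs.
have [|||||||x0 [l [Tx0 x0n eig0 min0]]] :=
    @rayleigh_min _ _ _ T (mulmx H) idfun 1.
- by move=> a x y; rewrite /T /= mulmxDr -scalemxAr => -> ->; rewrite scaler0 addr0.
- exact: (@closed_linear_ker _ _ _ _ (mulmx A)).
- by have [x Ax x0] := exists_orthogonal A kn; exists x.
- by move=> x y _ _; exact: Hsym.
- by move=> x y _ _; exact: ipC.
- exact: ltr01.
- by move=> x _; rewrite mul1r.
pose v := (fnorm x0)^-1 *: x0.
have nx0 : fnorm x0 != 0 by apply: contra x0n => /eqP/fnorm_eq0 ->.
have vv : ip v v = 1.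
  by rewrite ipZl ipZr mulrA -expr2 exprVn fnorm_sqr mulVf // -fnorm_sqr sqrf_eq0.
have uv j : (j < k)%N -> ip (u j) v = 0.
  by move=> jk; rewrite ipZr (proj1 (AE x0) Tx0) // mulr0.
(* Minimality gives the eigenvalue equation only against vectors of [T]. As [H] preserves the
   complement [T], the residual [w] lies in [T] and is orthogonal to itself. *)
have Hx0 : H *m x0 = l *: x0.
  apply/eqP; rewrite -subr_eq0; apply/eqP/ip_eq0.
  set w := H *m x0 - l *: x0.
  have Tw : T w.
    apply/AE => j jk; rewrite ipBr ipZr (proj1 (AE x0) Tx0) // Hsym eig //.
    by rewrite ipZr ipC (proj1 (AE x0) Tx0) // !mulr0 subrr.
  by rewrite {2}/w ipBr ipZr eig0 //= subrr.
have Hv : H *m v = l *: v by rewrite -scalemxAr Hx0 !scalerA mulrC.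
have dl j : (j < k)%N -> d j <= l.
  move=> jk; have := bound v j jk uv; rewrite Hv (ipZr l v v) vv.
  by rewrite !mulr1.
exists (fun i => if i == k then v else u i), (fun i => if i == k then l else d i).
have ltk i : (i < k.+1)%N -> i != k -> (i < k)%N by rewrite ltnS ltn_neqAle => -> ->.
split.
- move=> i j ik jk; have [->|iNk] := eqVneq i k.
    by have [_|jNk] := eqVneq j k; [rewrite vv|rewrite ipC uv ?ltk].
  by have [->|jNk] := eqVneq j k; [rewrite uv ?ltk // (negPf iNk)|rewrite ortho ?ltk].
- by move=> i ik; have [_|iNk] := eqVneq i k; [exact: Hv|rewrite eig ?ltk].
- move=> i j ij jk; case: (eqVneq i k) ij => [->|iNk] ij; case: (eqVneq j k) ij jk => [->|jNk] ij jk //.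
  + by have := ltk _ jk jNk; rewrite ltnNge ij.
  + by rewrite dl // ltn_neqAle iNk.
  + by rewrite sorted // ltk.
- move=> x i ik ux.
  have Tx : T x.
    apply/AE => j jk; have := ux j (ltnW jk : (j < k.+1)%N).
    by rewrite ltn_eqF.
  have lx := min0 x Tx.
  rewrite (le_trans _ lx) // ler_wpM2r ?ip_ge0 //.
  by have [//|iNk] := eqVneq i k; rewrite dl // ltk.
Qed.

Lemma real_spectral n (H : 'M[R]_n) : H^T = H -> exists U d, spec_decomp H U d.
Proof.
move=> Hs; have [u [d [ortho eig sorted _]]] := spectral_partial Hs (leqnn n).
pose U : 'M[R]_n := \matrix_(i, j) u j i 0.
have UU : U^T *m U = 1.
  apply/matrixP => i j; transitivity (ip (u i) (u j)); last by rewrite ortho // mxE.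
  by rewrite mxE ipE; apply: eq_bigr => k _; rewrite big_ord1 !mxE.
exists U, (fun i => d i); split=> //; split=> [i j ij|]; first exact: sorted.
have HU : H *m U = U *m diag_mx (\row_i d i).
  apply/matrixP => i j; rewrite mul_mx_diag [RHS]mxE !mxE.
  have /matrixP/(_ i 0) := eig j (ltn_ord j); rewrite !mxE => Hu.
  by rewrite [RHS]mulrC -Hu; apply: eq_bigr => k _; rewrite !mxE.
by rewrite -HU -mulmxA (mulmx1C UU) mulmx1.
Qed.

End Spectral.

(** * Spectral projectors and their perturbation *)

Section Aufbau.
Context {R : realType} {n : nat}.
Implicit Types (H P Q U M : 'M[R]_n) (d : 'I_n -> R).

Definition lowproj N U : 'M[R]_n := U *m diag_mx (\row_i (i < N)%N%:R) *m U^T.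

Lemma lowprojE N U :
  \sum_(i < n | (i < N)%N) (col i U *m (col i U)^T) = lowproj N U.
Proof.
apply/matrixP => a b; rewrite /lowproj mul_mx_diag summxE [RHS]mxE big_mkcond.
apply: eq_bigr => i _; rewrite !mxE; case: ifP => iN; last by rewrite mulr0 mul0r.
by rewrite big_ord1 !mxE mulr1.
Qed.

Lemma aufbau_projP N H Q : aufbau_proj N H Q ->
  exists U d, [/\ spec_decomp H U d, gap_at N d & Q = lowproj N U].
Proof. by move=> [U [d [Hd [gap ->]]]]; exists U, d; rewrite lowprojE. Qed.

Lemma trmx_lowproj N U : (lowproj N U)^T = lowproj N U.
Proof. by rewrite /lowproj !trmx_mul trmxK tr_diag_mx mulmxA. Qed.

Lemma lowproj_conj N U : U^T *m U = 1 ->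
  U^T *m lowproj N U *m U = diag_mx (\row_i (i < N)%N%:R).
Proof. by move=> UU; rewrite /lowproj !mulmxA UU mul1mx -mulmxA UU mulmx1. Qed.

Lemma lowproj_idem N U : U^T *m U = 1 -> lowproj N U *m lowproj N U = lowproj N U.
Proof.
move=> UU; have lU : lowproj N U *m U = U *m diag_mx (\row_i (i < N)%N%:R).
  by rewrite /lowproj -mulmxA UU mulmx1.
rewrite {2}/lowproj !mulmxA lU -(mulmxA U) mulmx_diag /lowproj.
congr (_ *m diag_mx _ *m _).
by apply/rowP => i; rewrite !mxE; case: (_ < _)%N; rewrite ?mulr1 ?mulr0.
Qed.

Lemma mxtrace_lowproj N U : U^T *m U = 1 -> (N <= n)%N -> \tr (lowproj N U) = N%:R.
Proof.
move=> UU Nn; rewrite /lowproj mxtrace_mulC mulmxA UU mul1mx mxtrace_diag.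
rewrite -[N in RHS]card_ord -sum1_card (big_ord_widen n (fun=> 1%N) Nn) natr_sum [RHS]big_mkcond.
by apply: eq_bigr => i _; rewrite mxE; case: (_ < _)%N.
Qed.

Lemma grassmann_lowproj N U : U^T *m U = 1 -> (N <= n)%N -> grassmann N (lowproj N U).
Proof.
by move=> UU Nn; split; [exact: trmx_lowproj|rewrite lowproj_idem // mxtrace_lowproj].
Qed.

Lemma lowproj_col N U i : U^T *m U = 1 ->
  lowproj N U *m col i U = (i < N)%N%:R *: col i U.
Proof.
move=> UU; rewrite colE mulmxA /lowproj -!mulmxA (mulmxA U^T) UU mul1mx scalemxAr.
congr (_ *m _); apply/colP => k; rewrite mul_diag_mx !mxE.
by case: eqVneq => [->|] /=; rewrite ?mulr0.
Qed.

Lemma spec_lowproj_comm N H U d : spec_decomp H U d ->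
  H *m lowproj N U = lowproj N U *m H.
Proof.
move=> [UU [_ ->]]; rewrite /lowproj !mulmxA -(mulmxA _ U^T U) -(mulmxA (_ *m _) U^T U).
by rewrite UU !mulmx1 -(mulmxA U) diag_mxC mulmxA.
Qed.

Lemma spec_decomp_tr H U d : spec_decomp H U d -> H^T = H.
Proof. by move=> [_ [_ ->]]; rewrite !trmx_mul trmxK tr_diag_mx mulmxA. Qed.

Lemma proj_diag M i : M^T = M -> M *m M = M -> 0 <= M i i <= 1.
Proof.
move=> Ms MM; have : M i i ^+ 2 <= M i i.
  rewrite -[in leRHS]MM mxE (bigD1 i) //= -expr2 lerDl sumr_ge0 // => k _.
  by rewrite -[in X in _ * X]Ms mxE -expr2 sqr_ge0.
by nra.
Qed.

Lemma mxtrace_spec H U d P : H = U *m diag_mx (\row_i d i) *m U^T ->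
  \tr (H *m P) = \sum_i d i * (U^T *m P *m U) i i.
Proof.
move=> ->; rewrite -!mulmxA mxtrace_mulC -!mulmxA (mulmxA U^T).
by apply: eq_bigr => i _; rewrite mul_diag_mx !mxE.
Qed.

Lemma ip_grassmannB N P Q : grassmann N P -> grassmann N Q ->
  ip (P - Q) (P - Q) = 2 * (N%:R - \tr (Q *m P)).
Proof.
move=> [Ps [PP trP]] [Qs [QQ trQ]].
rewrite ipBl !ipBr /ip Ps Qs PP QQ trP trQ (mxtrace_mulC P Q); ring.
Qed.

(** In the eigenbasis of [H] the diagonal entries [p i] of [P] lie in [0, 1] and sum to [N]. An
    index below [N] contributes nonnegatively to the energy difference, and an index from [N] on
    contributes at least the gap times [p i]. The squared distance is twice the sum of these latter
    [p i]. *)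
Lemma kyfan N H U d (i0 j0 : 'I_n) P : spec_decomp H U d -> (0 < N)%N ->
  i0 = N.-1 :> nat -> j0 = N :> nat -> grassmann N P ->
  (d j0 - d i0) / 2 * ip (P - lowproj N U) (P - lowproj N U)
    <= \tr (H *m P) - \tr (H *m lowproj N U).
Proof.
move=> [UU [sorted HE]] N0 i0E j0E gP.
have Nn : (N <= n)%N by rewrite -j0E ltnW.
have [Ps [PP trP]] := gP.
rewrite (ip_grassmannB gP (grassmann_lowproj UU Nn)) mulrA divfK ?pnatr_eq0 //.
rewrite !(mxtrace_spec _ HE) lowproj_conj //.
rewrite (@mxtrace_spec _ U (fun i => (i < N)%N%:R) P (erefl (lowproj N U))).
set p := fun i => (U^T *m P *m U) i i.
have pP i : 0 <= p i <= 1.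
  apply: proj_diag; first by rewrite !trmx_mul trmxK Ps mulmxA.
  by rewrite !mulmxA -(mulmxA _ U U^T) (mulmx1C UU) mulmx1 -(mulmxA _ P P) PP.
have sump : \sum_i p i = N%:R.
  by rewrite -trP -[in RHS](mul1mx P) -(mulmx1C UU) -mulmxA mxtrace_mulC.
have sumq : \sum_(i < n) ((i < N)%N%:R : R) = N%:R.
  rewrite -(mxtrace_lowproj UU Nn) /lowproj mxtrace_mulC mulmxA UU mul1mx mxtrace_diag.
  by apply: eq_bigr => i _; rewrite mxE.
have -> : N%:R - \sum_(i < n) (i < N)%N%:R * p i = \sum_(i < n) (p i - (i < N)%N%:R * p i).
  by rewrite sumrB sump.
(* Equality of the two traces allows all eigenvalues to be shifted by [d i0]. *)
have -> : \sum_i d i * p i - \sum_(i < n) d i * diag_mx (\row_i (i < N)%N%:R) i i =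
    \sum_(i < n) ((d i - d i0) * (p i - (i < N)%N%:R)).
  have -> : \sum_i d i * p i - \sum_(i < n) d i * diag_mx (\row_i (i < N)%N%:R) i i =
    \sum_i d i * p i - \sum_(i < n) d i * diag_mx (\row_i (i < N)%N%:R) i i
    - d i0 * (\sum_i p i - \sum_(i < n) (i < N)%N%:R) by rewrite sump sumq; ring.
  rewrite -!sumrB mulr_sumr -sumrB; apply: eq_bigr => i _.
  by rewrite !mxE eqxx mulr1n; ring.
rewrite mulr_sumr; apply: ler_sum => i _.
have /andP[p0 p1] := pP i.
case: ltnP => iN /=.
  have : d i <= d i0 by apply: sorted; rewrite i0E; case: (N) iN N0.
  by nra.
have : d j0 <= d i by apply: sorted; rewrite j0E.
by nra.
Qed.

(** Ky Fan for [H] at [Q'] is added to Ky Fan for [H'] at [Q]. The gap of [H'] may vanish, but its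
    term is nonnegative. The sum bounds the squared distance by [- ip (H' - H) (Q' - Q)], and
    Cauchy-Schwarz leaves one factor to cancel. *)
Lemma lowproj_perturb N H U d H' U' d' (i0 j0 : 'I_n) :
  spec_decomp H U d -> spec_decomp H' U' d' -> (0 < N)%N ->
  i0 = N.-1 :> nat -> j0 = N :> nat ->
  (d j0 - d i0) / 2 * fnorm (lowproj N U' - lowproj N U) <= fnorm (H' - H).
Proof.
move=> sH sH' N0 i0E j0E.
have Nn : (N <= n)%N by rewrite -j0E ltnW.
have := kyfan sH N0 i0E j0E (grassmann_lowproj sH'.1 Nn).
have := kyfan sH' N0 i0E j0E (grassmann_lowproj sH.1 Nn).
set Q := lowproj N U; set Q' := lowproj N U'.
have : 0 <= (d' j0 - d' i0) / 2 * ip (Q - Q') (Q - Q').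
  rewrite mulr_ge0 ?ip_ge0 // divr_ge0 // subr_ge0 sH'.2.1 // i0E j0E.
  exact: leq_pred.
move=> /le_trans/[apply] h1 h2.
have : (d j0 - d i0) / 2 * ip (Q' - Q) (Q' - Q) <= - ip (H' - H) (Q' - Q).
  have -> : ip (H' - H) (Q' - Q) = \tr ((H' - H) *m (Q' - Q)).
    by rewrite /ip (linearB (@trmx R n n)) /= (spec_decomp_tr sH) (spec_decomp_tr sH').
  rewrite mulmxBl !mulmxBr !linearB /=.
  by lra.
have := ler_ip (H' - H) (Q' - Q); rewrite ler_norml => /andP[h3 _] h4.
have [->|f0] := eqVneq (fnorm (Q' - Q)) 0; first by rewrite mulr0 fnorm_ge0.
have fpos : 0 < fnorm (Q' - Q) by rewrite lt_def f0 fnorm_ge0.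
by rewrite -(ler_pM2r fpos); move: h4; rewrite -fnorm_sqr; lra.
Qed.

Lemma spec_decomp_swap H U d (i0 j0 : 'I_n) : spec_decomp H U d -> d i0 = d j0 ->
  spec_decomp H (col_perm (tperm i0 j0) U) d.
Proof.
move=> [UU [sorted HE]] dij; split; [|split=> //].
  apply/matrixP => a b; have /matrixP/(_ (tperm i0 j0 a) (tperm i0 j0 b)) := UU.
  rewrite !mxE (inj_eq perm_inj) => <-; apply: eq_bigr => k _.
  by rewrite !mxE.
have dt i : d (tperm i0 j0 i) = d i by case: tpermP => [->|->|].
rewrite HE; apply/matrixP => a b; rewrite !mul_mx_diag mxE [RHS]mxE.
rewrite (reindex_inj (@perm_inj _ (tperm i0 j0))); apply: eq_bigr => k _.
by rewrite !mxE dt.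
Qed.

(* If the gap of [H'] closed, the projector would not be unique: exchanging the columns
   [i0] and [j0] of [U'] would give a second one, at distance at least 1 from the first,
   although both are close to the projector of [H]. *)
Lemma gap_perturb N H U d H' U' d' (i0 j0 : 'I_n) :
  spec_decomp H U d -> spec_decomp H' U' d' -> (0 < N)%N ->
  i0 = N.-1 :> nat -> j0 = N :> nat -> d i0 < d j0 ->
  fnorm (H' - H) < (d j0 - d i0) / 8 -> d' i0 < d' j0.
Proof.
move=> sH sH' N0 i0E j0E gap small; rewrite ltNge; apply/negP => dji.
have dij : d' i0 = d' j0.
  apply/eqP; rewrite eq_le dji andbT sH'.2.1 // i0E j0E; exact: leq_pred.
set U'' := col_perm (tperm i0 j0) U'.
have sH'' : spec_decomp H' U'' d' by exact: spec_decomp_swap.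
have := lowproj_perturb sH sH' N0 i0E j0E; have := lowproj_perturb sH sH'' N0 i0E j0E.
set Q := lowproj N U; set Q' := lowproj N U'; set Q'' := lowproj N U''.
have uE : col i0 U' = col j0 U''.
  by apply/colP => k; rewrite !mxE tpermR.
have Q'Q'' : (Q' - Q'') *m col i0 U' = col i0 U'.
  rewrite mulmxBl (lowproj_col _ _ sH'.1) [in X in _ - X]uE (lowproj_col _ _ sH''.1).
  by rewrite j0E ltnn i0E prednK // leqnn scale1r scale0r subr0.
have nu : fnorm (col i0 U') = 1.
  rewrite -[RHS]sqrtr1; congr Num.sqrt; have /matrixP/(_ i0 i0) := sH'.1.
  rewrite !mxE eqxx => UUi; rewrite -[RHS]UUi ipE; apply: eq_bigr => k _.
  by rewrite big_ord1 !mxE.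
have : 1 <= fnorm (Q' - Q'').
  by have := fnormM (Q' - Q'') (col i0 U'); rewrite Q'Q'' nu mulr1.
have : fnorm (Q' - Q'') <= fnorm (Q' - Q) + fnorm (Q'' - Q).
  by rewrite (_ : Q' - Q'' = (Q' - Q) - (Q'' - Q)) ?fnormB // opprB addrA subrK.
(* The perturbation bound puts each of the two distances below 1/4, against the lower bound 1 for
   their sum. *)
by nra.
Qed.

(** The last clause speaks of every aufbau projector of [H'], because [Phi] selects one by choice.
    The number [nu] is at once the admissible radius and the inverse of a Lipschitz constant. *)
Lemma aufbau_perturb N H Q : (0 < N)%N -> aufbau_proj N H Q ->
  exists2 nu, 0 < nu & forall H', H'^T = H' -> fnorm (H' - H) < nu ->
    [/\ has_gap N H', exists Q', aufbau_proj N H' Q' &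
     forall Q', aufbau_proj N H' Q' ->
       [/\ grassmann N Q', H' *m Q' = Q' *m H' & nu * fnorm (Q' - Q) <= fnorm (H' - H)]].
Proof.
move=> N0 /aufbau_projP[U [d [sH [i0 [j0 [i0E [j0E gap]]]] QE]]].
exists ((d j0 - d i0) / 8) => [|H' H's small]; first by rewrite divr_gt0 // subr_gt0.
have [U' [d' sH']] := real_spectral H's.
have gap' : gap_at N d'.
  by exists i0, j0; split=> //; split=> //; exact: (gap_perturb sH sH' N0 i0E j0E gap small).
split; first by exists U', d'.
  by exists (lowproj N U'), U', d'; rewrite lowprojE.
move=> Q' /aufbau_projP[U2 [d2 [sH2 _ ->]]]; split.
- by apply: (grassmann_lowproj sH2.1); rewrite -j0E ltnW.
- exact: spec_lowproj_comm sH2.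
- have := lowproj_perturb sH sH2 N0 i0E j0E; rewrite -QE.
  by have := fnorm_ge0 (lowproj N U2 - Q); nra.
Qed.

End Aufbau.

(** * Second order expansion of the energy *)

Section Calculus.
Context {R : realType}.

Lemma eq0_of_small (x C : R) : (forall e, 0 < e -> `|x| <= e * C) -> x = 0.
Proof.
move=> h; apply/eqP; rewrite -normr_le0; apply/ler_addgt0Pr => e e0.
rewrite add0r; have C1 : 0 < `|C| + 1 by rewrite ltr_wpDl.
apply: (le_trans (h (e / (`|C| + 1)) _)); first by rewrite divr_gt0.
rewrite -mulrA ler_piMr ?(ltW e0) // mulrC ler_pdivrMr // mul1r.
by rewrite (le_trans (ler_norm _)) // lerDl.
Qed.

Lemma exists_small_scale (x d : R) : 0 <= x -> 0 < d -> exists2 s, 0 < s & s * x < d.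
Proof.
move=> x0 d0; have x1 : 0 < x + 1 by rewrite ltr_wpDl.
exists (d / (x + 1)); first by rewrite divr_gt0.
by rewrite mulrAC ltr_pdivrMr // ltr_pM2l // ltrDl.
Qed.

Lemma differentiable_fnormP m n p q (f : 'M[R]_(m, n) -> 'M[R]_(p, q)) x :
  differentiable f x -> forall e, 0 < e -> exists2 d, 0 < d &
  forall h, fnorm h < d -> fnorm (f (x + h) - f x - 'd f x h) <= e * fnorm h.
Proof.
move=> /diff_locallyP[_ /eqaddoP fo] e e0.
pose K : R := (p * q)%:R + 1.
have K0 : 0 < K by rewrite ltr_wpDl.
have /nbhs_norm0P[d /= d0 fd] := fo (e / K) (divr_gt0 e0 K0).
exists d => // h hd.
have -> : f (x + h) - f x - 'd f x h = (f \o shift x - (cst (f x) + 'd f x)) h.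
  transitivity (f (h + x) - (f x + 'd f x h)) => //.
  by rewrite opprD addrA (addrC h).
have /fd le_h := le_lt_trans (mx_norm_le_fnorm h) hd.
apply: (le_trans (fnorm_le_mx_norm _)).
apply: (@le_trans _ _ (K * (e / K * fnorm h))).
  apply: ler_pM => //; first by rewrite lerDl.
  by apply: (le_trans le_h); rewrite ler_wpM2l ?mx_norm_le_fnorm // ltW ?divr_gt0.
by rewrite mulrA mulrCA mulfV ?mulr1 // gt_eqF.
Qed.

Lemma is_derive_line (V : normedModType R) (f : V -> R) a v (t : R) :
  differentiable f (a + t *: v) ->
  is_derive t 1 (fun s => f (a + s *: v)) ('d f (a + t *: v) v).
Proof.
move=> df; have := @diff_derivable _ _ _ f _ v df; rewrite -(deriveE v df).
have E : (fun h : R => h^-1 *: ((f \o shift (a + t *: v)) (h *: v) - f (a + t *: v))) =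
  (fun h => h^-1 *: (((fun s : R => f (a + s *: v)) \o shift t) (h *: 1) - f (a + t *: v))).
  apply/funext => h /=; rewrite (_ : h *: 1 = h) ?[_ *: 1]mulr1 //.
  by rewrite scalerDl addrCA.
rewrite /derivable /derive E => cf; split; first exact: cf.
by [].
Qed.

Lemma mvt_bound (f df : R -> R) (s c K : R) : 0 <= s ->
  (forall x : R, is_derive x 1 f (df x)) ->
  (forall x, 0 <= x <= s -> `|df x - c| <= K) ->
  `|f s - f 0 - c * s| <= K * s.
Proof.
move=> s0 fd dfK; have [|x xs ->] := @MVT_segment R f df 0 s s0 (fun x _ => fd x).
  apply: derivable_within_continuous => x _; exact: ex_derive.
rewrite subr0 -mulrBl normrM (ger0_norm s0) ler_wpM2r //.
by apply: dfK; move: xs; rewrite in_itv.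
Qed.

End Calculus.

Section Gradient.
Context {R : realType} {n : nat}.
Variables (E : 'M[R]_n -> R).
Hypothesis E2 : C2 E.
Implicit Types P D u v : 'M[R]_n.

Lemma trmx_gradE P : (gradE E P)^T = gradE E P.
Proof. by apply/matrixP => i j; rewrite !mxE addrC. Qed.

Lemma diff_gradE P D : D^T = D -> 'd E P D = ip (gradE E P) D.
Proof.
move=> Ds; have dE (X : 'M[R]_n) : 'd E P X = \sum_i \sum_j X i j * 'd E P (delta_mx i j).
  rewrite {1}(matrix_sum_delta X) linear_sum; apply: eq_bigr => i _.
  by rewrite linear_sum; apply: eq_bigr => j _; rewrite linearZ.
have -> : 'd E P D = ('d E P D + 'd E P D^T) / 2 by rewrite Ds; field.
rewrite !dE [X in _ + X]exchange_big -big_split mulr_suml ipE; apply: eq_bigr => i _.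
rewrite -big_split mulr_suml; apply: eq_bigr => j _ /=.
by rewrite !mxE; ring.
Qed.

Lemma differentiable_gradE P : differentiable (gradE E) P.
Proof.
have -> : gradE E = \sum_i \sum_j (fun Q => (('d E Q (delta_mx i j) +
    'd E Q (delta_mx j i)) / 2) *: (delta_mx i j : 'M[R]_n)).
  apply/funext => Q; rewrite [LHS]matrix_sum_delta fct_sumE; apply: eq_bigr => i _.
  by rewrite fct_sumE; apply: eq_bigr => j _; rewrite !mxE.
apply: differentiable_sum => i; apply: differentiable_sum => j.
apply: differentiableZl.
have -> : (fun Q => ('d E Q (delta_mx i j) + 'd E Q (delta_mx j i)) / 2) =
   2^-1 *: ((fun Q => 'd E Q (delta_mx i j)) + (fun Q => 'd E Q (delta_mx j i))).
  by apply/funext => Q; rewrite mulrC.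
apply/differentiableZ/differentiableD; exact: (E2.2 _).1.
Qed.

Lemma gradE_expand P e : 0 < e -> exists2 d, 0 < d & forall h, fnorm h < d ->
  fnorm (gradE E (P + h) - gradE E P - hessE E P h) <= e * fnorm h.
Proof. exact/differentiable_fnormP/differentiable_gradE. Qed.

Lemma is_derive_E P D (t : R) : D^T = D ->
  is_derive t 1 (fun s => E (P + s *: D)) (ip (gradE E (P + t *: D)) D).
Proof. by move=> Ds; rewrite -diff_gradE //; exact/is_derive_line/E2.1.1. Qed.

Lemma hessED P u v : hessE E P (u + v) = hessE E P u + hessE E P v.
Proof. exact: linearD. Qed.

Lemma hessEZ P a u : hessE E P (a *: u) = a *: hessE E P u.
Proof. exact: linearZ. Qed.

(** Increments of the gradient are symmetric matrices, so the antisymmetric part of the differential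
    comes from the Taylor remainder alone, which is o(s) along [s *: D]. *)
Lemma trmx_hessE P D : (hessE E P D)^T = hessE E P D.
Proof.
apply/eqP; rewrite -subr_eq0; apply/eqP/fnorm_eq0.
apply: (@eq0_of_small _ _ (2 * fnorm D)) => e e0.
have [d d0 hd] := gradE_expand P e0.
have [s s0 sD] := exists_small_scale (fnorm_ge0 D) d0.
rewrite -{1}(gtr0_norm s0) -fnormZ in sD.
have := hd _ sD; set r := _ - _ - _ => rs.
have rE : s *: ((hessE E P D)^T - hessE E P D) = r - r^T.
  rewrite /r hessEZ; have := trmx_gradE P; have := trmx_gradE (P + s *: D).
  move: (gradE E P) (gradE E (P + s *: D)) (hessE E P D) => b a c ta tb.
  apply/matrixP => i j; have aji : a j i = a i j by rewrite -{1}ta mxE.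
  have bji : b j i = b i j by rewrite -{1}tb mxE.
  by rewrite !mxE aji bji; ring.
have : s * fnorm ((hessE E P D)^T - hessE E P D) <= s * (e * (2 * fnorm D)).
  rewrite -{1}(gtr0_norm s0) -fnormZ rE (le_trans (fnormB _ _)) // fnorm_tr.
  by move: rs; rewrite fnormZ gtr0_norm //; lra.
by rewrite ler_pM2l // ger0_norm.
Qed.

Lemma taylor2 P e : 0 < e -> exists2 d, 0 < d & forall D, D^T = D -> fnorm D < d ->
  `|E (P + D) - E P - ip (gradE E P) D - ip D (hessE E P D) / 2| <= e * ip D D.
Proof.
move=> e0; have [d d0 hd] := gradE_expand P e0; exists d => // D Ds Dd.
pose a := ip D (hessE E P D).
(* With the quadratic term subtracted, the derivative of [f] stays within [e * ip D D] of its value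
   at 0, and the mean value bound applies on [0, 1]. *)
pose f (t : R) := E (P + t *: D) - t ^+ 2 * (a / 2).
have fd (t : R) : is_derive t 1 f (ip (gradE E (P + t *: D)) D - t * a).
  apply: is_deriveB; first exact: is_derive_E.
  by apply: is_derive_eq; rewrite /GRing.scale /=; field.
have := @mvt_bound _ _ _ 1 (ip (gradE E P) D) (e * ip D D) ler01 fd.
rewrite /f scale1r scale0r addr0 expr0n mul0r subr0 expr1n mul1r !mulr1 => h.
have -> : E (P + D) - E P - ip (gradE E P) D - a / 2 =
  E (P + D) - a / 2 - E P - ip (gradE E P) D by ring.
apply: h => t /andP[t0 t1].
have tD : fnorm (t *: D) <= fnorm D by rewrite fnormZ ger0_norm // ler_piMl.
have := hd _ (le_lt_trans tD Dd).
have -> : ip (gradE E (P + t *: D)) D - t * a - ip (gradE E P) D =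
   ip (gradE E (P + t *: D) - gradE E P - hessE E P (t *: D)) D.
  rewrite /a hessEZ (ipC D).
  move: (gradE E _) (gradE E _) (hessE E P D) => g1 g2 g3.
  by rewrite !ipBl ipZl; ring.
move=> hr; apply: (le_trans (ler_ip _ _)); rewrite -fnorm_sqr expr2 mulrA ler_wpM2r //.
by rewrite (le_trans hr) // ler_wpM2l // ltW.
Qed.

(** The mean value bound is applied in direction [u] to the increment of [E] in direction [v]. Two
    gradient remainders occur, each at most [e] times s (|u| + |v|), whence the factor 2. *)
Lemma second_difference P u v e d s : u^T = u -> v^T = v -> 0 < s ->
  (forall h, fnorm h < d ->
    fnorm (gradE E (P + h) - gradE E P - hessE E P h) <= e * fnorm h) -> 0 < e ->
  s * (fnorm u + fnorm v) < d ->
  `|E (P + s *: u + s *: v) - E (P + s *: u) - E (P + s *: v) + E P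
     - s ^+ 2 * ip (hessE E P v) u|
  <= s ^+ 2 * (e * (2 * (fnorm u + fnorm v) ^+ 2)).
Proof.
move=> us vs s0 hd e0 sd.
pose f (t : R) := E (P + s *: v + t *: u) - E (P + t *: u).
have fd (t : R) : is_derive t 1 f
   (ip (gradE E (P + s *: v + t *: u)) u - ip (gradE E (P + t *: u)) u).
  by apply: is_deriveB; exact: is_derive_E.
pose w := fnorm u + fnorm v.
have u0 := fnorm_ge0 u; have v0 := fnorm_ge0 v.
have := @mvt_bound _ _ _ s (s * ip (hessE E P v) u) (s * (e * (2 * w ^+ 2))) (ltW s0) fd.
rewrite /f !scale0r !addr0 => h.
have -> : E (P + s *: u + s *: v) - E (P + s *: u) - E (P + s *: v) + E P
     - s ^+ 2 * ip (hessE E P v) u = E (P + s *: v + s *: u) - E (P + s *: u)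
   - (E (P + s *: v) - E P) - s * ip (hessE E P v) u * s.
  by rewrite (addrAC P (s *: u)); ring.
have -> : s ^+ 2 * (e * (2 * w ^+ 2)) = s * (e * (2 * w ^+ 2)) * s by ring.
apply: h => t /andP[t0 ts].
have n1 : fnorm (s *: v + t *: u) <= s * w.
  rewrite (le_trans (fnormD _ _)) // !fnormZ (ger0_norm t0) (gtr0_norm s0) /w; nra.
have n2 : fnorm (t *: u) <= s * w by rewrite fnormZ (ger0_norm t0) /w; nra.
pose r1 := gradE E (P + t *: u) - gradE E P - hessE E P (t *: u).
pose r2 := gradE E (P + s *: v + t *: u) - gradE E P - hessE E P (s *: v + t *: u).
have hr1 : fnorm r1 <= e * fnorm (t *: u) := hd _ (le_lt_trans n2 sd).
have hr2 : fnorm r2 <= e * fnorm (s *: v + t *: u).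
  by have := hd _ (le_lt_trans n1 sd); rewrite addrA.
have -> : ip (gradE E (P + s *: v + t *: u)) u - ip (gradE E (P + t *: u)) u
   - s * ip (hessE E P v) u = ip (r2 - r1) u.
  rewrite /r1 /r2 hessED !hessEZ.
  move: (gradE E _) (gradE E _) (gradE E _) (hessE E P u) (hessE E P v) => g1 g2 g3 g4 g5.
  by rewrite !(ipBl, ipDl, ipZl); ring.
apply: (le_trans (ler_ip _ _)).
have : fnorm (r2 - r1) <= s * (e * (2 * w)).
  apply: (le_trans (fnormB _ _)).
  have := ler_wpM2l (ltW e0) n1; have := ler_wpM2l (ltW e0) n2; lra.
have uw : fnorm u <= w by rewrite lerDl.
move=> hr; have := ler_pM (fnorm_ge0 _) u0 hr uw.
by rewrite expr2; lra.
Qed.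

(** Schwarz's theorem: the second difference is symmetric in [u] and [v], and approximates s^2 times
    either pairing. The two errors add up to the factor 4. *)
Lemma hessE_sym P u v : u^T = u -> v^T = v ->
  ip u (hessE E P v) = ip v (hessE E P u).
Proof.
move=> us vs; apply/eqP; rewrite -subr_eq0; apply/eqP.
set w := fnorm u + fnorm v.
have w0 : 0 <= w by rewrite addr_ge0.
apply: (@eq0_of_small _ _ (4 * w ^+ 2)) => e e0.
have [d d0 hd] := gradE_expand P e0.
have [s s0 sw] := exists_small_scale w0 d0.
have h1 := second_difference us vs s0 hd e0 sw.
have := second_difference vs us s0 hd e0; rewrite (addrC (fnorm v)) => /(_ sw) h2.
rewrite (addrAC P) in h2.
rewrite -/w in h1 h2.
have s20 : 0 < s ^+ 2 by rewrite exprn_gt0.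
rewrite -(ler_pM2l s20) -{1}(gtr0_norm s20) -normrM !(ipC _ (hessE _ _ _)).
move: h1 h2; rewrite !ler_norml => /andP[h1 h2] /andP[h3 h4].
by apply/andP; split; lra.
Qed.

End Gradient.

(** * Tangent space and the operator Omega *)

Section MatrixEntries.
Context {R : pzRingType} {m n : nat}.
Implicit Types A B : 'M[R]_(m, n).

Lemma mx_entryD A B i j : (A + B) i j = A i j + B i j. Proof. by rewrite mxE. Qed.
Lemma mx_entryN A i j : (- A) i j = - A i j. Proof. by rewrite mxE. Qed.
Lemma mx_entryZ a A i j : (a *: A) i j = a * A i j. Proof. by rewrite mxE. Qed.
Lemma mx_entry0 i j : (0 : 'M[R]_(m, n)) i j = 0. Proof. by rewrite mxE. Qed.
End MatrixEntries.

Definition mx_entry := (@mx_entryD, @mx_entryN, @mx_entryZ, @mx_entry0).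

Lemma mulmxZl (R : pzRingType) m n p a (A : 'M[R]_(m, n)) (B : 'M_(n, p)) :
  (a *: A) *m B = a *: (A *m B).
Proof. by rewrite scalemxAl. Qed.

Lemma mulmxZr (R : comPzRingType) m n p a (A : 'M[R]_(m, n)) (B : 'M_(n, p)) :
  A *m (a *: B) = a *: (A *m B).
Proof. by rewrite scalemxAr. Qed.

Definition mx_distr := (@mulmxDl, @mulmxDr, @mulmxBl, @mulmxBr, @mulmxN, @mulNmx,
  @mulmxZl, @mulmxZr, @mul1mx, @mulmx1, @mulmxA).

(** Once products are distributed, the identities to be proved are linear in the matrix monomials.
    They can be checked entrywise by [ring], although matrices do not commute. *)
Ltac mx_linear := apply/matrixP => ? ?; rewrite !mx_entry; ring.

Section Tangent.
Context {R : realType} {n : nat}.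
Variables P H : 'M[R]_n.
Hypothesis Ps : P^T = P.
Hypothesis PP : P *m P = P.
Implicit Types X Y Q D : 'M[R]_n.

Lemma mulmxPP m (X : 'M[R]_(m, n)) : X *m P *m P = X *m P.
Proof. by rewrite -mulmxA PP. Qed.

Lemma PiPE X : PiP P X = P *m X + X *m P - 2 *: (P *m X *m P).
Proof. by rewrite /PiP !mx_distr; mx_linear. Qed.

Lemma PiP_linear : linear (PiP P).
Proof. by move=> a X Y; rewrite !PiPE !mx_distr; mx_linear. Qed.
HB.instance Definition _ := GRing.isLinear.Build R 'M[R]_n 'M[R]_n _ (PiP P) PiP_linear.

Lemma tangentE X : tangent P X <-> X^T = X /\ P *m X + X *m P = X.
Proof.
rewrite /tangent /= /symmH; split=> [[Xs [PXP QXQ]]|[Xs XE]]; split=> //.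
  apply/eqP; rewrite -subr_eq0; apply/eqP; rewrite -[RHS]oppr0 -[in RHS]QXQ !mx_distr PXP.
  by mx_linear.
have PXP : P *m X *m P = 0.
  have : P *m X = P *m (P *m X + X *m P) by rewrite XE.
  by rewrite mulmxDr !mulmxA PP => /eqP; rewrite addrC -subr_eq subrr eq_sym => /eqP.
split=> //; rewrite !mx_distr PXP -[X in X - _]XE; mx_linear.
Qed.

Lemma tangent_tr X : tangent P X -> X^T = X.
Proof. by case. Qed.

Lemma tangent_linear a X Y : tangent P X -> tangent P Y -> tangent P (a *: X + Y).
Proof.
move=> /tangentE[Xs XE] /tangentE[Ys YE]; apply/tangentE; split.
  by rewrite linearP /= Xs Ys.
by rewrite -[in RHS]XE -[in RHS]YE !mx_distr; mx_linear.
Qed.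

Lemma tangent0 : tangent P 0.
Proof. by apply/tangentE; rewrite trmx0 mulmx0 mul0mx addr0. Qed.

Lemma tangentD X Y : tangent P X -> tangent P Y -> tangent P (X + Y).
Proof. by move=> TX TY; rewrite -(scale1r X); exact: tangent_linear. Qed.

Lemma tangentZ a X : tangent P X -> tangent P (a *: X).
Proof. by move=> TX; rewrite -(addr0 (a *: X)); apply: tangent_linear => //; exact: tangent0. Qed.

Lemma tangentB X Y : tangent P X -> tangent P Y -> tangent P (X - Y).
Proof. by move=> TX TY; rewrite -scaleN1r; apply: tangentD => //; exact: tangentZ. Qed.

Lemma trmx_PiP X : (PiP P X)^T = PiP P X^T.
Proof.
rewrite !PiPE linearB linearD linearZ /= !trmx_mul Ps !mulmxA; mx_linear.
Qed.

Lemma PiP_comm X : P *m PiP P X + PiP P X *m P = PiP P X.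
Proof. by rewrite !PiPE !mx_distr !(mulmxPP, PP); mx_linear. Qed.

Lemma tangent_PiP X : X^T = X -> tangent P (PiP P X).
Proof. by move=> Xs; apply/tangentE; rewrite PiP_comm trmx_PiP Xs. Qed.

Lemma tangent_corner X : tangent P X -> P *m X *m P = 0.
Proof. by case=> _ []. Qed.

Lemma PiP_id X : tangent P X -> PiP P X = X.
Proof.
move=> TX; rewrite PiPE tangent_corner //; have /tangentE[_ ->] := TX.
by rewrite scaler0 subr0.
Qed.

Lemma PiP_idem X : PiP P (PiP P X) = PiP P X.
Proof. by rewrite [in LHS]PiPE PiP_comm PiPE !mx_distr !(mulmxPP, PP); mx_linear. Qed.

Lemma ip_PiP X Y : ip (PiP P X) Y = ip X (PiP P Y).
Proof.
have l Z W : ip (P *m Z) W = ip Z (P *m W) by rewrite ip_mulmxl Ps.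
have r Z W : ip (Z *m P) W = ip Z (W *m P) by rewrite ip_mulmxr Ps.
by rewrite !PiPE !(ipBl, ipBr, ipDl, ipDr, ipZl, ipZr) !(l, r) mulmxA.
Qed.

Lemma tangent_closed : closed (tangent P : set 'M[R]_n).
Proof.
have -> : tangent P = [set X | (X - X^T = 0)] `&` [set X | X - PiP P X = 0].
  apply/seteqP; split=> X /=.
    by move=> TX; rewrite PiP_id // (tangent_tr TX) subrr.
  by move=> [/eqP + /eqP]; rewrite !subr_eq0 => /eqP Xs /eqP ->; exact: tangent_PiP.
apply: closedI.
  exact: (@closed_linear_ker _ _ _ _ _ (idfun \- @trmx R n n)).
exact: (@closed_linear_ker _ _ _ _ _ (idfun \- PiP P)).
Qed.

Hypothesis Hs : H^T = H.
Hypothesis HP : H *m P = P *m H.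

(* Locked: otherwise rewriting with distributivity unfolds it. *)
Definition signedH : 'M[R]_n := locked (H - 2 *: (H *m P)).
Local Notation B := signedH.

Lemma signedHE : signedH = H - 2 *: (H *m P).
Proof. by rewrite /signedH -lock. Qed.

Lemma trmx_signedH : B^T = B.
Proof. by rewrite signedHE linearB linearZ /= trmx_mul Hs Ps HP. Qed.

(** Here [B] is H on the range of 1 - P and -H on the range of P. In an eigenbasis the
    anticommutator thus multiplies the off-diagonal entry (a, i) by the difference of an unoccupied
    and an occupied eigenvalue. It agrees with [Omega] on tangent vectors, and is linear and
    symmetric on all matrices. *)
Definition omega X : 'M[R]_n := B *m X + X *m B.

Lemma omega_linear : linear omega.
Proof. by move=> a X Y; rewrite /omega !mx_distr; mx_linear. Qed.
HB.instance Definition _ := GRing.isLinear.Build R 'M[R]_n 'M[R]_n _ omega omega_linear.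

Lemma commutator_omega X : tangent P X ->
  - (P *m (H *m X - X *m H) - (H *m X - X *m H) *m P) = omega X.
Proof.
move=> /tangentE[_ XE]; have PX : P *m X = X - X *m P by rewrite -{2}XE addrK.
have HPX : H *m P *m X = H *m X - H *m X *m P by rewrite -mulmxA PX mulmxBr mulmxA.
have PXH : P *m X *m H = X *m H - X *m H *m P.
  by rewrite PX mulmxBl -(mulmxA X P H) -HP mulmxA.
by rewrite /omega signedHE !mx_distr -!HP HPX PXH; mx_linear.
Qed.

Lemma omega_sym X Y : ip X (omega Y) = ip Y (omega X).
Proof.
rewrite /omega !ipDr -{1}trmx_signedH -ip_mulmxl ipC -{2}trmx_signedH -ip_mulmxr.
by congr (_ + _); rewrite ipC.
Qed.

Lemma signedH_comm : B *m P = P *m B.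
Proof. by rewrite signedHE !mx_distr -!HP !mulmxPP. Qed.

Lemma tangent_omega X : tangent P X -> tangent P (omega X).
Proof.
move=> /tangentE[Xs XE]; apply/tangentE; split.
  by rewrite /omega linearD /= !trmx_mul Xs trmx_signedH addrC.
have XBP : X *m B *m P = X *m P *m B by rewrite -mulmxA signedH_comm mulmxA.
by rewrite /omega -[in RHS]XE !mx_distr -signedH_comm XBP; mx_linear.
Qed.

Lemma ip_omega X : X^T = X -> ip X (omega X) = 2 * ip X (B *m X).
Proof.
move=> Xs; rewrite /omega ipDr -(ip_trmx X (X *m B)) trmx_mul trmx_signedH Xs; ring.
Qed.

(* The first-order variation of [Tr (H Q)] at a projector commuting with [H] vanishes;
   what remains is exactly quadratic. *)
Lemma ip_projB Q : Q *m Q = Q -> Q^T = Q -> ip H (Q - P) = ip (Q - P) (B *m (Q - P)).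
Proof.
move=> QQ Qs; set D := Q - P.
(* Idempotence of [P + D]; with the symmetry of [D] this is all that is kept about [Q]. *)
have DE : P *m D + D *m P + D *m D = D.
  by rewrite /D !mx_distr QQ PP; mx_linear.
have Ds : D^T = D by rewrite /D linearB /= Qs Ps.
clearbody D.
have trHP : \tr (H *m P *m D) = - \tr (H *m P *m D *m D).
  have : \tr (H *m P *m D) = \tr (H *m P *m (P *m D + D *m P + D *m D)) by rewrite DE.
  rewrite !mx_distr mulmxPP !linearD /= (mxtrace_mulC _ P) !mulmxA -HP mulmxPP.
  by lra.
have trHDP : \tr (H *m D *m P) = \tr (H *m P *m D).
  by rewrite mxtrace_mulC mulmxA HP.
have trHD : \tr (H *m D) = \tr (H *m (P *m D + D *m P + D *m D)) by rewrite DE.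
rewrite /ip Hs Ds trHD (mxtrace_mulC D) signedHE !mx_distr !linearB !linearD /= linearZ /=.
by rewrite trHDP trHP; ring.
Qed.

Lemma PiP_comm_comm X : P *m (P *m X - X *m P) - (P *m X - X *m P) *m P = PiP P X.
Proof. by rewrite PiPE !mx_distr !(mulmxPP, PP); mx_linear. Qed.

(* [Q] commutes with [H + W]: projecting [[Q, H + W] = 0] gives the first order
   response of the spectral projector to the perturbation [W]. *)
Lemma omega_response Q W : Q^T = Q -> (H + W) *m Q = Q *m (H + W) ->
  omega (PiP P (Q - P)) =
  - PiP P W - (P *m ((Q - P) *m W - W *m (Q - P)) - ((Q - P) *m W - W *m (Q - P)) *m P).
Proof.
move=> Qs Qc; set D := Q - P.
have Ds : D^T = D by rewrite /D linearB /= Qs Ps.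
rewrite -commutator_omega; last exact: tangent_PiP.
have QE : Q = P + D by rewrite addrC subrK.
clearbody D.
have HD : H *m D - D *m H = (P *m W - W *m P) + (D *m W - W *m D).
  move: Qc; rewrite QE !mx_distr HP => /matrixP Qc.
  by apply/matrixP => i j; have := Qc i j; rewrite !mx_entry; lra.
(* The part of [D] removed by [PiP] is block diagonal, and so is its commutator with [H]; the
   commutator with [P] annihilates it. *)
have -> : P *m (H *m PiP P D - PiP P D *m H) - (H *m PiP P D - PiP P D *m H) *m P =
  P *m (H *m D - D *m H) - (H *m D - D *m H) *m P.
  have ZPH (Z : 'M[R]_n) : Z *m P *m H = Z *m H *m P by rewrite -mulmxA -HP mulmxA.
  by rewrite PiPE !mx_distr -!HP !(PP, mulmxPP, ZPH); mx_linear.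
by rewrite HD -PiP_comm_comm !mx_distr; mx_linear.
Qed.

End Tangent.

(** * Spectral radius of the linearised iteration *)

Section SpectralRadius.
Context {R : realType} {n : nat}.
Variables (T : set 'M[R]_n) (Om K : {linear 'M[R]_n -> 'M[R]_n}) (J : 'M[R]_n -> 'M[R]_n).
Variables (c eta : R).
Hypothesis Tlin : forall a x y, T x -> T y -> T (a *: x + y).
Hypothesis Tclosed : closed T.
Hypothesis Tneq0 : exists2 X, T X & X != 0.
Hypothesis Om_sym : forall x y, T x -> T y -> ip x (Om y) = ip y (Om x).
Hypothesis K_sym : forall x y, T x -> T y -> ip x (K y) = ip y (K x).
Hypothesis c0 : 0 < c.
Hypothesis Om_ge : forall x, T x -> c * ip x x <= ip x (Om x).
Hypothesis eta0 : 0 < eta.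
Hypothesis OmK_ge : forall x, T x -> eta * ip x x <= ip x (Om x + K x).
Hypothesis TJ : forall x, T x -> T (J x).
Hypothesis OmJ : forall x, T x -> Om (J x) = Om x + K x.

Let g : {linear 'M[R]_n -> 'M[R]_n} := Om \+ K.
Let q x := ip x (Om x).

Let T0 : T 0.
Proof. by case: Tneq0 => X TX _; have := Tlin (-1) TX TX; rewrite scaleN1r addNr. Qed.

Let TD a b x y : T x -> T y -> T (a *: x + b *: y).
Proof. by move=> Tx Ty; apply: Tlin => //; have := Tlin b Ty T0; rewrite addr0. Qed.

Let q_ge0 x : T x -> 0 <= q x.
Proof. by move=> Tx; rewrite (le_trans _ (Om_ge Tx)) // mulr_ge0 ?ip_ge0 // ltW. Qed.

Let q_eq0 x : T x -> q x = 0 -> x = 0.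
Proof.
move=> Tx qx; apply: ip_eq0; apply/eqP; rewrite eq_le ip_ge0 andbT.
by rewrite -(ler_pM2l c0) mulr0 -qx Om_ge.
Qed.

Let g_sym x y : T x -> T y -> ip x (g y) = ip y (g x).
Proof. by move=> Tx Ty; rewrite /= !ipDr Om_sym // K_sym. Qed.

(* In the inner product [x, y |-> ip x (Om y)], [J] is self-adjoint and positive, so
   for small [beta] the norm of [1 - beta J] is its largest eigenvalue. *)
Lemma specrad_contraction : exists2 beta0, 0 < beta0 &
  forall beta, 0 < beta -> beta < beta0 ->
  let rho := specrad_on T (fun X => X - beta *: J X) in
  [/\ 0 < rho, rho < 1 &
   forall x, T x -> ip (x - beta *: J x) (Om (x - beta *: J x)) <= rho ^+ 2 * ip x (Om x)].
Proof.
have [X0 [l [TX0 X00 eigX0 lmin]]] := rayleigh_min Tlin Tclosed Tneq0 g_sym Om_sym c0 Om_ge.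
have qX0 : 0 < q X0.
  by rewrite lt_def q_ge0 // andbT; apply: contra X00 => /eqP/(q_eq0 TX0) ->.
have l0 : 0 < l.
  rewrite -(pmulr_lgt0 _ qX0) -/(q X0) -eigX0 //=.
  by rewrite (lt_le_trans _ (OmK_ge TX0)) // mulr_gt0 // ip_gt0.
have [G G0 gG] := linear_fnorm_bound g.
have g_le x : T x -> ip x (g x) <= G / c * q x.
  move=> Tx; have := le_trans (ler_norm _) (ler_ip x (g x)).
  have := ler_wpM2l (fnorm_ge0 x) (gG x); rewrite mulrCA -expr2 fnorm_sqr => h1 h2.
  apply: (le_trans h2); apply: (le_trans h1).
  by rewrite -mulrA ler_pM2l // ler_pdivlMl // Om_ge.
have lG : l <= G / c.
  by rewrite -(ler_pM2r qX0) -/(q X0) -[X in X <= _]eigX0 // g_le.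
have JX0 : J X0 = l *: X0.
  apply/eqP; rewrite -subr_eq0; apply/eqP; set w := J X0 - l *: X0.
  have Tw : T w.
    by have := TD 1 (- l) (TJ TX0) TX0; rewrite scale1r scaleNr.
  apply: q_eq0 => //; rewrite /q {2}/w linearB linearZ /= OmJ // ipBr ipZr.
  by have /= -> := eigX0 _ Tw; rewrite subrr.
(* Below this bound [beta] times the form of [g] is dominated by that of [Om], so 1 - beta J stays
   nonnegative and its norm comes from the smallest eigenvalue [l] of [J]. *)
exists (c / G) => [|beta beta0 betaG]; first by rewrite divr_gt0.
have betaGc : beta * (G / c) < 1.
  rewrite mulrA ltr_pdivrMr // mul1r -ltr_pdivlMr //.
pose mu := 1 - beta * l.
have mu0 : 0 < mu.
  by rewrite subr_gt0; apply: le_lt_trans betaGc; rewrite ler_pM2l.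
have mu1 : mu < 1 by rewrite gtrBl mulr_gt0.
pose L X := X - beta *: J X.
have TL x : T x -> T (L x).
  by move=> Tx; have := TD 1 (- beta) Tx (TJ Tx); rewrite scale1r scaleNr.
have qL x : T x -> q (L x) <= mu ^+ 2 * q x.
  (* The form [f] pairs [z] with [L y] in the Omega product. It is nonnegative and at most [mu]
     times [q]; Cauchy-Schwarz at [L x] and [x] bounds [q (L x) ^+ 2], and one factor [q (L x)]
     cancels. *)
  move=> Tx; pose f x y := ip x (Om y) - beta * ip x (g y).
  have fL y : T y -> forall z, ip z (Om (L y)) = f z y.
    by move=> Ty z; rewrite linearB linearZ /= OmJ // ipBr ipZr.
  have f_le z : T z -> f z z <= mu * q z.
    move=> Tz; rewrite /f /mu -/(q z) mulrBl mul1r lerD2l lerN2 -mulrA ler_pM2l //.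
    exact: lmin.
  have f_ge0 z : T z -> 0 <= f z z.
    move=> Tz; rewrite /f -/(q z) subr_ge0.
    apply: (@le_trans _ _ (beta * (G / c) * q z)).
      by rewrite -mulrA ler_pM2l // g_le.
    by rewrite ler_piMl ?q_ge0 // ltW.
  have CS : f (L x) x ^+ 2 <= f (L x) (L x) * f x x.
    apply: (@psd_CauchySchwarz _ _ T f) => //; last exact: TL.
    - by move=> a y z w; rewrite /f !ipDl !ipZl; ring.
    - by move=> y z Ty Tz; rewrite /f Om_sym // g_sym.
  have qLx := q_ge0 (TL _ Tx); rewrite -(fL x Tx) -/(q (L x)) in CS.
  have : q (L x) ^+ 2 <= mu * q (L x) * (mu * q x).
    by apply: (le_trans CS); apply: ler_pM; rewrite ?f_ge0 ?f_le //; exact: TL.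
  have [->|q0] := eqVneq (q (L x)) 0; first by rewrite mulr_ge0 ?sqr_ge0 ?q_ge0.
  have qpos : 0 < q (L x) by rewrite lt_def q0.
  move=> h; rewrite -(ler_pM2l qpos); move: h; rewrite !expr2; lra.
have eigL : eigen_on T L mu 0.
  exists X0, 0; split=> //; split=> //; split; first by left.
  have LX0 : L X0 = mu *: X0 by rewrite /L JX0 scalerA /mu scalerBl scale1r.
  rewrite LX0 !scale0r scaler0 subr0 addr0; split=> //.
  (* [J] is given only as a function, so [L 0 = 0] is read off from the contraction bound. *)
  apply/(q_eq0 (TL _ T0))/eqP; rewrite eq_le q_ge0 ?andbT; last exact: TL.
  by rewrite (le_trans (qL _ T0)) // /q ip0l mulr0.
have -> : specrad_on T L = mu.
  pose S := [set r : R | exists a b : R, eigen_on T L a b /\ r = Num.sqrt (a ^+ 2 + b ^+ 2)].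
  have Smu : S mu.
    exists mu, 0; split=> //; by rewrite expr0n addr0 sqrtr_sqr gtr0_norm.
  have Sub : ubound S mu.
    move=> r [a [b [[X [Y [TX [TY [XY0 [LX LY]]]]]] ->]]].
    rewrite -(gtr0_norm mu0) -sqrtr_sqr ler_sqrt ?sqr_ge0 //.
    have qXY : 0 < q X + q Y.
      have := q_ge0 TX; have := q_ge0 TY => qY qX.
      rewrite lt_def addr_ge0 // andbT paddr_eq0 //.
      by apply/negP => /andP[/eqP/(q_eq0 TX) X0' /eqP/(q_eq0 TY) Y0'];
        case: XY0; rewrite ?X0' ?Y0' eqxx.
    rewrite -(ler_pM2r qXY).
    (* For an eigenvalue a + i b the cross terms of [q (L X)] and [q (L Y)] cancel, and their sum is
       (a^2 + b^2) (q X + q Y). *)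
    have := lerD (qL _ TX) (qL _ TY).
    have e a' b' : q (a' *: X + b' *: Y) = a' ^+ 2 * q X + 2 * a' * b' * ip X (Om Y) + b' ^+ 2 * q Y.
      apply: (@psd_expand _ _ T (fun x y => ip x (Om y))) => //.
      by move=> a1 x y z; rewrite ipDl ipZl.
    rewrite LX LY -scaleNr !e; lra.
  apply/eqP; rewrite eq_le; apply/andP; split.
    by apply: ge_sup => //; exists mu.
  by apply: ub_le_sup => //; exists mu.
by split.
Qed.

End SpectralRadius.

(** * From chords of a set to its tangent vectors *)

Section QuadraticLimit.
Context {R : realType} {n : nat}.
Variables (S : set 'M[R]_n) (P X : 'M[R]_n).

(* [X] is a velocity at [P] of curves in [S]. *)
Lemma quadratic_form_limit (f : {linear 'M[R]_n -> 'M[R]_n}) d0 C d : 0 < d0 -> 0 < d ->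
  (forall t, 0 < t -> fnorm (t *: X) < d0 ->
     exists2 Q, S Q & fnorm (Q - (P + t *: X)) <= C * fnorm (t *: X) ^+ 2) ->
  (forall Q, S Q -> fnorm (Q - P) < d -> 0 <= ip (Q - P) (f (Q - P))) ->
  0 <= ip X (f X).
Proof.
move=> d00 dpos curve pos; rewrite leNgt; apply/negP => neg.
have [F F0 fF] := linear_fnorm_bound f.
set x := fnorm X; have x0 : 0 <= x by exact: fnorm_ge0.
pose k := `|C| * x ^+ 2.
have k0 : 0 <= k by rewrite mulr_ge0 // sqr_ge0.
(* With the remainder [r] of size at most t^2 k, the form at the chord t X + r is at most t^2 (ip X
   (f X) + t M), which is negative for small t if [ip X (f X)] is. *)
pose M := 2 * x * F * k + F * k ^+ 2.
have M0 : 0 <= M.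
  by rewrite addr_ge0 ?mulr_ge0 ?sqr_ge0 ?(ltW F0).
have kE : k = `|C| * x ^+ 2 by [].
have ME : M = 2 * x * F * k + F * k ^+ 2 by [].
clearbody k M.
have [t t0 small] : exists2 t, 0 < t & t * (1 + x + k + M) <
    Num.min (Num.min 1 d0) (Num.min d (- ip X (f X))).
  apply: exists_small_scale; first lra.
  by rewrite !lt_min ltr01 d00 dpos oppr_gt0.
move: small; rewrite !lt_min => /andP[/andP[t1 td0] /andP[td tq]].
have tx : 0 <= t * x by rewrite mulr_ge0 // ltW.
have tk : 0 <= t * k by rewrite mulr_ge0 // ltW.
have tM : 0 <= t * M by rewrite mulr_ge0 // ltW.
rewrite !mulrDr mulr1 in t1 td0 td tq.
have tX : fnorm (t *: X) = t * x by rewrite fnormZ gtr0_norm.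
have [Q SQ] := curve t t0 (ltac:(rewrite tX; lra)).
set r := Q - (P + t *: X) => rC.
have DE : Q - P = t *: X + r by rewrite /r; mx_linear.
clearbody r.
have {}rC : fnorm r <= t ^+ 2 * k.
  apply: (le_trans rC); rewrite tX exprMn kE.
  by rewrite mulrCA ler_pM2l ?exprn_gt0 // ler_wpM2r ?sqr_ge0 // ler_norm.
have tt : t ^+ 2 * k <= t * k by rewrite ler_wpM2r // expr2 ler_piMl ?(ltW t0) //; lra.
have := pos Q SQ; rewrite DE => /(_ _)/[!linearD]/[!linearZ] /=.
have -> : fnorm (t *: X + r) < d by apply: (le_lt_trans (fnormD _ _)); rewrite tX; lra.
move=> /(_ isT); rewrite !(ipDl, ipDr, ipZl, ipZr) => h.
have r0 := fnorm_ge0 r.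
have rb : forall Y Z, ip Y (f Z) <= F * (fnorm Y * fnorm Z).
  move=> Y Z; apply: (le_trans (le_trans (ler_norm _) (ler_ip _ _))).
  by rewrite mulrCA ler_wpM2l.
have t20 : 0 < t ^+ 2 by rewrite exprn_gt0.
have h1 : t * ip X (f r) <= t ^+ 2 * (t * (F * (x * k))).
  have -> : t ^+ 2 * (t * (F * (x * k))) = t * (F * (x * (t ^+ 2 * k))) by ring.
  by rewrite ler_pM2l // (le_trans (rb _ _)) // ler_pM2l // ler_wpM2l.
have h2 : t * ip r (f X) <= t ^+ 2 * (t * (F * (x * k))).
  have -> : t ^+ 2 * (t * (F * (x * k))) = t * (F * ((t ^+ 2 * k) * x)) by ring.
  by rewrite ler_pM2l // (le_trans (rb _ _)) // ler_pM2l // ler_wpM2r.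
have h3 : ip r (f r) <= t ^+ 2 * (t * (F * k ^+ 2)).
  apply: (le_trans (rb _ _)).
  have -> : t ^+ 2 * (t * (F * k ^+ 2)) = F * ((t ^+ 2 * k) * (t * k)) by ring.
  by rewrite ler_pM2l // ler_pM // (le_trans rC).
have : 0 <= t ^+ 2 * (ip X (f X) + t * M).
  by rewrite ME; lra.
by rewrite pmulr_rge0 //; lra.
Qed.

End QuadraticLimit.

(** * First order expansions and linear convergence *)

Section LocalOrder.
Context {R : realType} {n : nat}.
Variables (S : set 'M[R]_n) (P : 'M[R]_n).
Implicit Types f g : 'M[R]_n -> 'M[R]_n.

Lemma near_fnormP (p : 'M[R]_n -> Prop) :
  (\forall Q \near within S (nbhs P), p Q) <->
  exists2 d, 0 < d & forall Q, S Q -> fnorm (Q - P) < d -> p Q.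
Proof.
split=> [/nbhs_normP[d /= d0 dp]|[d d0 dp]].
  exists d => // Q SQ Qd; apply: dp => //=.
  by rewrite distrC (le_lt_trans (mx_norm_le_fnorm _)).
have K0 : 0 < (n * n)%:R + 1 :> R by rewrite ltr_wpDl.
apply/(@nbhs_normP _ 'M[R]_n P (fun Q => S Q -> p Q)); exists (d / ((n * n)%:R + 1)); first by rewrite /= divr_gt0.
move=> Q /= QP SQ; apply: dp => //.
rewrite fnormC (le_lt_trans (fnorm_le_mx_norm _)) //.
move: QP; rewrite ltr_pdivlMr // => /(le_lt_trans _); apply.
by rewrite mulrC ler_wpM2l // lerDl.
Qed.

Definition bigOat f :=
  exists2 C, 0 < C & \forall Q \near within S (nbhs P), fnorm (f Q) <= C * fnorm (Q - P).

Definition littleoat f :=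
  forall e, 0 < e -> \forall Q \near within S (nbhs P), fnorm (f Q) <= e * fnorm (Q - P).

Lemma near_eq_littleoat f g :
  (\forall Q \near within S (nbhs P), f Q = g Q) -> littleoat f -> littleoat g.
Proof. by move=> fg fo e /fo; apply: filterS2 fg => Q ->. Qed.

Lemma near_eq_bigOat f g :
  (\forall Q \near within S (nbhs P), f Q = g Q) -> bigOat f -> bigOat g.
Proof. by move=> fg [C C0 fC]; exists C => //; apply: filterS2 fg fC => Q ->. Qed.

Lemma near_mem : \forall Q \near within S (nbhs P), S Q.
Proof. by apply/near_fnormP; exists 1. Qed.

Lemma littleoat_bigOat f : littleoat f -> bigOat f.
Proof. by move=> fo; exists 1 => //; exact: fo. Qed.

Lemma bigOat_id : bigOat (fun Q => Q - P).
Proof. by exists 1 => //; apply: nearW => Q; rewrite mul1r. Qed.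

Lemma bigOatD f g : bigOat f -> bigOat g -> bigOat (fun Q => f Q + g Q).
Proof.
move=> [C C0 fC] [D D0 gD]; exists (C + D); first exact: addr_gt0.
apply: filterS2 fC gD => Q h1 h2; rewrite (le_trans (fnormD _ _)) // mulrDl.
exact: lerD.
Qed.

Lemma littleoatD f g : littleoat f -> littleoat g -> littleoat (fun Q => f Q + g Q).
Proof.
move=> fo go e e0; have e20 : 0 < e / 2 by rewrite divr_gt0.
apply: filterS2 (fo _ e20) (go _ e20) => Q h1 h2.
by rewrite (le_trans (fnormD _ _)) // (splitr e) mulrDl lerD.
Qed.

Lemma bigOat_linear (l : {linear 'M[R]_n -> 'M[R]_n}) f :
  bigOat f -> bigOat (fun Q => l (f Q)).
Proof.
have [D D0 lD] := linear_fnorm_bound l.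
move=> [C C0 fC]; exists (D * C); first exact: mulr_gt0.
apply: filterS fC => Q h; rewrite (le_trans (lD _)) // -mulrA.
by rewrite ler_wpM2l // ltW.
Qed.

Lemma littleoat_linear (l : {linear 'M[R]_n -> 'M[R]_n}) f :
  littleoat f -> littleoat (fun Q => l (f Q)).
Proof.
have [D D0 lD] := linear_fnorm_bound l.
move=> fo e e0; apply: filterS (fo (e / D) _) => [Q h|]; last by rewrite divr_gt0.
rewrite (le_trans (lD _)) // -ler_pdivlMl //.
by move: h; rewrite mulrA (mulrC e).
Qed.

Lemma bigOatZ a f : bigOat f -> bigOat (fun Q => a *: f Q).
Proof. exact: (bigOat_linear (a \*: idfun)). Qed.

Lemma littleoatZ a f : littleoat f -> littleoat (fun Q => a *: f Q).
Proof. exact: (littleoat_linear (a \*: idfun)). Qed.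

Lemma bigOatB f g : bigOat f -> bigOat g -> bigOat (fun Q => f Q - g Q).
Proof.
move=> fO /(bigOatZ (-1)) gO; have := bigOatD fO gO.
by under eq_fun do rewrite scaleN1r.
Qed.

Lemma littleoatB f g : littleoat f -> littleoat g -> littleoat (fun Q => f Q - g Q).
Proof.
move=> fO /(littleoatZ (-1)) gO; have := littleoatD fO gO.
by under eq_fun do rewrite scaleN1r.
Qed.

Lemma bigOat_small f e : 0 < e -> bigOat f ->
  \forall Q \near within S (nbhs P), fnorm (f Q) < e.
Proof.
move=> e0 [C C0 fC].
have : \forall Q \near within S (nbhs P), fnorm (Q - P) < e / C.
  by apply/near_fnormP; exists (e / C) => //; rewrite divr_gt0.
apply: filterS2 fC => Q h; rewrite ltr_pdivlMr // mulrC; exact: le_lt_trans.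
Qed.

Lemma littleoat_le f (h : 'M[R]_n -> R) C : 0 < C ->
  (\forall Q \near within S (nbhs P), fnorm (f Q) <= C * h Q * fnorm (Q - P)) ->
  (forall e, 0 < e -> \forall Q \near within S (nbhs P), h Q < e) -> littleoat f.
Proof.
move=> C0 fh h0 e e0; apply: filterS2 fh (h0 (e / C) _) => [Q h1 h2|]; last by rewrite divr_gt0.
rewrite (le_trans h1) // ler_wpM2r // -ler_pdivlMl // mulrC; exact: ltW.
Qed.

Lemma littleoat_mul f g : bigOat f -> bigOat g -> littleoat (fun Q => f Q *m g Q).
Proof.
move=> fO [D D0 gD]; apply: (@littleoat_le _ (fun Q => fnorm (f Q)) D) => //.
  apply: filterS gD => Q h; rewrite (le_trans (fnormM _ _)) // (mulrC D) -mulrA.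
  exact: ler_wpM2l.
by move=> e e0; exact: bigOat_small.
Qed.

End LocalOrder.

Section LinearConvergence.
Context {R : realType} {X : Type}.

(* Near the fixed point the rate is below any [rho + theta]; the finitely many first
   steps only enter the constant. *)
Lemma asymptotic_rate (S G : set X) (F : X -> X) (a : X -> R) rho :
  0 < rho -> rho < 1 -> (forall x, 0 <= a x) ->
  (forall e, 0 < e -> exists2 d, 0 < d &
     forall x, S x -> a x < d -> [/\ G x, S (F x) & a (F x) <= (rho + e) * a x]) ->
  exists2 d, 0 < d &
    (forall x, S x -> a x < d -> forall k, S (iter k F x) /\ G (iter k F x)) /\
    (forall theta, 0 < theta -> exists2 C, 0 < C &
       forall x, S x -> a x < d -> forall k, a (iter k F x) <= C * (rho + theta) ^+ k * a x).
Proof.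
move=> rho0 rho1 a0 step.
(* A crude rate [r0], the midpoint of [rho] and 1, keeps every orbit in the ball and drives it to
   the fixed point. *)
have e0 : 0 < (1 - rho) / 2 by rewrite divr_gt0 // subr_gt0.
have [d d0 hd] := step _ e0; set r0 := rho + _ in hd.
have r00 : 0 < r0 by rewrite addr_gt0.
have r01 : r0 < 1 by rewrite /r0; lra.
have inv x k : S x -> a x < d -> S (iter k F x) /\ a (iter k F x) <= r0 ^+ k * a x.
  move=> Sx xd; elim: k => [|k [Sk ak]]; first by rewrite expr0 mul1r.
  have akd : a (iter k F x) < d.
    by rewrite (le_lt_trans (le_trans ak _) xd) // ler_piMl // exprn_ile1 // ltW.
  have [_ SF aF] := hd _ Sk akd; split=> //=.
  by rewrite (le_trans aF) // exprS -mulrA ler_pM2l.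
have small x k : S x -> a x < d -> a (iter k F x) <= a x.
  by move=> Sx xd; rewrite (le_trans (inv x k Sx xd).2) // ler_piMl // exprn_ile1 // ltW.
exists d => //; split=> [x Sx xd k|theta theta0].
  have [Sk _] := inv x k Sx xd; split=> //.
  by have [] := hd _ Sk (le_lt_trans (small _ _ Sx xd) xd).
have [r0t|tr0] := leP r0 (rho + theta).
  exists 1 => // x Sx xd k; rewrite mul1r (le_trans (inv x k Sx xd).2) //.
  by rewrite ler_wpM2r // lerXn2r // nnegrE ltW // addr_gt0.
have [d' d'0 hd'] := step _ theta0.
(* The number of steps needed to enter the smaller ball is uniform over all starting points in the
   larger one. *)
have [k0 hk0] : exists k0, r0 ^+ k0 * d < d'.
  have r0n : `|r0| < 1 by rewrite gtr0_norm.
  have /cvgrPdist_lt/(_ _ (divr_gt0 d'0 d0))[k0 _ hk0] := cvg_expr r0n.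
  exists k0; have := hk0 k0 (leqnn k0); rewrite /= sub0r normrN ger0_norm ?exprn_ge0 ?ltW //.
  by rewrite ltr_pdivlMr.
set r := rho + theta in tr0 hd' *.
have rpos : 0 < r by rewrite addr_gt0.
have r1 : r <= 1 by rewrite ltW // (lt_trans tr0).
have tail x k : S x -> a x < d -> a (iter (k + k0) F x) <= r ^+ k * a (iter k0 F x).
  move=> Sx xd; elim: k => [|k IH]; first by rewrite expr0 mul1r.
  have [Sk ak] := inv x (k + k0)%N Sx xd.
  have akd' : a (iter (k + k0) F x) < d'.
    apply: (le_lt_trans ak); apply: le_lt_trans hk0.
    apply: (@le_trans _ _ (r0 ^+ k0 * a x)); last by rewrite ler_pM2l ?exprn_gt0 // ltW.
    by rewrite ler_wpM2r // ler_wiXn2l ?leq_addl // ltW.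
  have [_ _ aF] := hd' _ Sk akd'; rewrite addSn /= (le_trans aF) //.
  by rewrite exprS -mulrA ler_pM2l.
(* This constant absorbs the first [k0] steps, during which only monotone decrease is used. *)
exists (r ^- k0) => [|x Sx xd k]; first by rewrite invr_gt0 exprn_gt0.
have [kk0|k0k] := leqP k0 k.
  rewrite -(subnK kk0) (le_trans (tail _ _ Sx xd)) // exprD mulrCA mulVf ?mulr1; last first.
    by rewrite gt_eqF // exprn_gt0.
  by rewrite ler_pM2l ?exprn_gt0 // small.
rewrite (le_trans (small _ _ Sx xd)) // ler_peMl // ler_pdivlMl ?exprn_gt0 // mulr1.
by rewrite ler_wiXn2l ?(ltnW k0k) // ltW.
Qed.

End LinearConvergence.

(** * Positivity and invertibility of Omega and of the Hessian *)

Section LinearisedSCF.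
Context {R : realType} {n : nat}.
Variables (N : nat) (E : 'M[R]_n -> R) (P : 'M[R]_n).
Hypothesis N0 : (0 < N)%N.
Hypothesis E2 : C2 E.
Hypothesis gP : grassmann N P.
Hypothesis aufbau : aufbau_proj N (gradE E P) P.
Let H := gradE E P.
Let A : {linear 'M[R]_n -> 'M[R]_n} := 'd (gradE E) P.
Let Ps : P^T = P. Proof. by case: gP. Qed.
Let PP : P *m P = P. Proof. by case: gP => _ []. Qed.
Let Hs : H^T = H. Proof. exact: trmx_gradE. Qed.

Lemma aufbau_comm : H *m P = P *m H.
Proof.
have [U [d [sH _ PE]]] := aufbau_projP aufbau.
by rewrite PE (spec_lowproj_comm N sH).
Qed.
Let HP := aufbau_comm.

Definition Khess : {linear 'M[R]_n -> 'M[R]_n} := PiP P \o ('d (gradE E) P \o PiP P).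

Lemma KhessE X : Khess X = Kop E P X. Proof. by []. Qed.

Lemma Omega_omega X : tangent P X -> Omega E P X = omega P H X.
Proof. exact: commutator_omega. Qed.

Lemma tangent_Khess X : X^T = X -> tangent P (Khess X).
Proof.
by move=> Xs; apply: (tangent_PiP Ps PP); apply: (@trmx_hessE _ _ _ E2).
Qed.

Lemma Khess_ip X Y : tangent P X -> tangent P Y -> ip X (Khess Y) = ip X (hessE E P Y).
Proof. by move=> TX TY; rewrite /= -ip_PiP // !PiP_id. Qed.

Lemma Khess_sym X Y : tangent P X -> tangent P Y -> ip X (Khess Y) = ip Y (Khess X).
Proof.
move=> TX TY; rewrite !Khess_ip //.
exact: (hessE_sym E2) (tangent_tr TX) (tangent_tr TY).
Qed.

(** The gap supplies an occupied eigenvector [u] and an unoccupied one [v], and u v^T + v u^T is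
    tangent. Rayleigh minimisation on the tangent space needs such a nonzero vector. *)
Lemma tangent_neq0 : exists2 X, tangent P X & X != 0.
Proof.
have [U [d [[UU _] [i0 [j0 [i0E [j0E _]]]] PE]]] := aufbau_projP aufbau.
pose u := col i0 U; pose v := col j0 U.
have Pu : P *m u = u.
  by rewrite PE (lowproj_col _ _ UU) i0E prednK // leqnn scale1r.
have Pv : P *m v = 0 by rewrite PE (lowproj_col _ _ UU) j0E ltnn scale0r.
have uv i j : (col i U)^T *m col j U = (i == j)%:R%:M.
  apply/matrixP => a b; rewrite !ord1 !mxE eqxx mulr1n.
  have /matrixP/(_ i j) := UU; rewrite !mxE => <-.
  by apply: eq_bigr => k _; rewrite !mxE.
have ij : (i0 == j0) = false.
  by apply/eqP => ij; move: i0E; rewrite ij j0E => /eqP; rewrite -[X in X == _]prednK // gtn_eqF.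
exists (u *m v^T + v *m u^T).
  apply/(tangentE PP); split.
    by rewrite linearD /= !trmx_mul !trmxK addrC.
  rewrite mulmxDr mulmxDl !mulmxA Pu Pv mul0mx addr0 -!(mulmxA _ _^T P).
  have -> : v^T *m P = 0 by rewrite -[LHS]trmxK trmx_mul trmxK Ps Pv trmx0.
  have -> : u^T *m P = u^T by rewrite -[LHS]trmxK trmx_mul trmxK Ps Pu.
  by rewrite mulmx0 add0r.
apply/negP => /eqP X0.
have : (u *m v^T + v *m u^T) *m v = u.
  rewrite mulmxDl -!mulmxA (uv j0 j0) (uv i0 j0) eqxx ij mulmx1.
  by rewrite (_ : 0%:R%:M = 0) ?mulmx0 ?addr0 // raddf0.
rewrite X0 mul0mx => u0; have := uv i0 i0; rewrite -/u -u0 mulmx0 eqxx => /matrixP/(_ 0 0).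
by rewrite !mxE eqxx => /eqP; rewrite eq_sym oner_eq0.
Qed.

Variable Rt : 'M[R]_n -> 'M[R]_n.
Variables delta C : R.
Hypothesis delta0 : 0 < delta.
Hypothesis retr : forall Q X : 'M[R]_n, grassmann N Q -> symmH X -> frob X < delta ->
  grassmann N (Rt (Q + X)) /\
  frob (Rt (Q + X) - (Q + PiP Q X)) <= C * frob X ^+ 2.

Lemma tangent_curve X : tangent P X -> forall t, 0 < t -> fnorm (t *: X) < delta ->
  exists2 Q, grassmann N Q & fnorm (Q - (P + t *: X)) <= C * fnorm (t *: X) ^+ 2.
Proof.
move=> TX t t0 tX; have TtX := tangentZ PP t TX.
have [gQ QX] := retr gP (tangent_tr TtX) tX.
by exists (Rt (P + t *: X)) => //; move: QX; rewrite PiP_id.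
Qed.

(** The retraction, applied to [P + t *: X], gives points of the manifold within O(t^2) of it, so a
    bound on chords passes to [X] in the limit. *)
Lemma tangent_form_ge (f : {linear 'M[R]_n -> 'M[R]_n}) c d X : 0 < d ->
  (forall Q, grassmann N Q -> fnorm (Q - P) < d ->
    c * ip (Q - P) (Q - P) <= ip (Q - P) (f (Q - P))) ->
  tangent P X -> c * ip X X <= ip X (f X).
Proof.
move=> d0 fc TX; rewrite -subr_ge0 -ipZr -ipBr.
have := @quadratic_form_limit _ _ (grassmann N) P X (f \- c \*: idfun) _ C _
  delta0 d0 (tangent_curve TX); apply.
by move=> Q gQ Qd; rewrite /= ipBr ipZr subr_ge0 fc.
Qed.

Lemma ip_gradE_projB Q : grassmann N Q ->
  ip H (Q - P) = ip (Q - P) (signedH P H *m (Q - P)).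
Proof. by move=> [Qs [QQ _]]; exact: ip_projB. Qed.

Lemma omega_ge : exists2 c, 0 < c & forall X, tangent P X -> c * ip X X <= ip X (omega P H X).
Proof.
have [U [d [sH [i0 [j0 [i0E [j0E gap]]]] PE]]] := aufbau_projP aufbau.
(* Ky Fan yields half the gap for the form of [signedH]; the form of [omega] is twice that one. *)
exists (d j0 - d i0) => [|X TX]; first by rewrite subr_gt0.
rewrite (ip_omega Ps Hs HP (tangent_tr TX)).
have : (d j0 - d i0) / 2 * ip X X <= ip X (signedH P H *m X); last by lra.
apply: (@tangent_form_ge (mulmx (signedH P H)) _ 1 X ltr01) => // Q gQ _ /=.
rewrite -ip_gradE_projB // /ip Hs.
have := kyfan sH N0 i0E j0E gQ; rewrite -PE => /le_trans; apply.
by rewrite mulmxBr linearB.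
Qed.

(** The first order term of the Taylor expansion is itself quadratic in the chord and contributes
    the curvature term [omega]. Half of [eta] is spent on the Taylor remainder, and doubling the
    resulting form restores it. *)
Lemma hessian_ge eta d : 0 < eta -> 0 < d ->
  (forall Q : 'M[R]_n, grassmann N Q -> frob (Q - P) < d ->
     E P + eta * frob (Q - P) ^+ 2 <= E Q) ->
  forall X, tangent P X -> eta * ip X X <= ip X (omega P H X + Khess X).
Proof.
move=> eta0 d0 minE X TX; rewrite ipDr Khess_ip // (ip_omega Ps Hs HP (tangent_tr TX)).
have [d1 d10 hd1] := taylor2 E2 P (divr_gt0 eta0 (ltr0n R 2)).
pose f : {linear 'M[R]_n -> 'M[R]_n} := mulmx (signedH P H) \+ 2^-1 \*: A.
have fE Y : ip Y (f Y) = ip Y (signedH P H *m Y) + 2^-1 * ip Y (hessE E P Y).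
  by rewrite [f Y]/= ipDr ipZr.
have : eta / 2 * ip X X <= ip X (f X); last first.
  by rewrite fE; lra.
apply: (@tangent_form_ge f _ (Num.min d d1)) => //; first by rewrite lt_min d0.
move=> Q gQ; rewrite lt_min => /andP[Qd Qd1].
have Ds : (Q - P)^T = Q - P by rewrite linearB /= Ps; case: gQ => ->.
have := hd1 _ Ds Qd1; rewrite (addrC P) subrK -/H ip_gradE_projB // ler_norml => /andP[_].
have := minE Q gQ Qd; rewrite frobE fnorm_sqr.
by rewrite fE; lra.
Qed.

(** With [p] the orthogonal projection onto the tangent space, [G] acts as [omega] there and as the
    identity on the complement. Coercivity makes [G] injective, hence surjective by finite
    dimension, and [p] maps a preimage of [Y] to a tangent one. *)
Lemma Omega_invP Y : tangent P Y ->
  tangent P (Omega_inv E P Y) /\ omega P H (Omega_inv E P Y) = Y.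
Proof.
move=> TY; have [c c0 om_ge] := omega_ge.
suff [Z [TZ ZY]] : exists Z, tangent P Z /\ omega P H Z = Y.
  have [] : [set Z | tangent P Z /\ Omega E P Z = Y] (Omega_inv E P Y).
    by apply: xgetPex; exists Z; rewrite /= Omega_omega.
  by move=> TI; rewrite Omega_omega.
pose p : {linear 'M[R]_n -> 'M[R]_n} := PiP P \o (2^-1 \*: (idfun \+ @trmx R n n)).
have Tp X : tangent P (p X).
  by apply: (tangent_PiP Ps PP); rewrite linearZ linearD /= trmxK addrC.
have pT X : tangent P X -> p X = X.
  move=> TX; rewrite -[RHS](PiP_id PP TX) -[p X]/(PiP P (2^-1 *: (X + X^T))).
  by congr PiP; rewrite (tangent_tr TX); apply/matrixP => i j; rewrite !mx_entry; field.
pose G : {linear 'M[R]_n -> 'M[R]_n} := (omega P H \o p) \+ (idfun \- p).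
have pG X : p (G X) = omega P H (p X).
  rewrite linearD linearB (pT (p X)) // subrr addr0 pT //.
  exact: tangent_omega.
have G0 X : G X = 0 -> X = 0.
  move=> GX; have := pG X; rewrite GX linear0 => /esym om0.
  have pX : p X = 0.
    apply: ip_eq0; apply/eqP; rewrite eq_le ip_ge0 andbT -(ler_pM2l c0) mulr0.
    by rewrite (le_trans (om_ge _ (Tp X))) // om0 ip0r.
  by move: GX; rewrite -[G X]/(omega P H (p X) + (X - p X)) pX linear0 add0r subr0.
have /lker0_limgf Gfull : lker (linfun G) == 0%VS.
  rewrite -subv0; apply/subvP => X; rewrite memv_ker lfunE => /eqP/G0 ->.
  exact: mem0v.
have : Y \in limg (linfun G) by rewrite Gfull memvf.
move=> /memv_imgP[Z _]; rewrite lfunE => YE.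
by exists (p Z); split=> //; rewrite -pG -YE pT.
Qed.

End LinearisedSCF.

(** * Expansion of one SCF step *)

Lemma PiP_shift (R : realType) n (P X Z : 'M[R]_n) :
  PiP (P + X) Z = PiP P Z + (X *m Z + Z *m X
    - 2 *: (X *m Z *m P + P *m (Z *m X) + X *m Z *m X)).
Proof. by rewrite !PiPE !mx_distr; mx_linear. Qed.

(** The normal part of a chord between projectors is quadratic in the chord. *)
Lemma projB_normal (R : realType) n (P Q : 'M[R]_n) : P *m P = P -> Q *m Q = Q ->
  (Q - P) - PiP P (Q - P) = (Q - P) *m (Q - P) - 2 *: (P *m ((Q - P) *m (Q - P) *m P)).
Proof.
move=> PP QQ; rewrite PiPE !mx_distr !(QQ, PP, mulmxPP PP) -(mulmxA P Q Q) QQ; mx_linear.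
Qed.

Section OneStep.
Context {R : realType} {n : nat}.
Variables (N : nat) (E : 'M[R]_n -> R) (P : 'M[R]_n).
Hypothesis N0 : (0 < N)%N.
Hypothesis E2 : C2 E.
Hypothesis gP : grassmann N P.
Hypothesis aufbau : aufbau_proj N (gradE E P) P.
Variable Rt : 'M[R]_n -> 'M[R]_n.
Variables delta C : R.
Hypothesis delta0 : 0 < delta.
Hypothesis retr : forall Q X : 'M[R]_n, grassmann N Q -> symmH X -> frob X < delta ->
  grassmann N (Rt (Q + X)) /\
  frob (Rt (Q + X) - (Q + PiP Q X)) <= C * frob X ^+ 2.
Let H := gradE E P.
Let A : {linear 'M[R]_n -> 'M[R]_n} := 'd (gradE E) P.
Let S : set 'M[R]_n := grassmann N.
Let Ps : P^T = P. Proof. by case: gP. Qed.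
Let PP : P *m P = P. Proof. by case: gP => _ []. Qed.
Let Hs : H^T = H. Proof. exact: trmx_gradE. Qed.
Let HP : H *m P = P *m H. Proof. exact: aufbau_comm aufbau. Qed.
Let D Q := Phi N E Q - P.
Let W Q := gradE E Q - H.

Let W_littleo : littleoat S P (fun Q => W Q - A (Q - P)).
Proof.
move=> e e0; have [d d0 hd] := gradE_expand E2 P e0.
apply/near_fnormP; exists d => // Q _ /hd.
by rewrite (addrC P) subrK.
Qed.

Let W_bigO : bigOat S P W.
Proof.
have := bigOatD (littleoat_bigOat W_littleo) (bigOat_linear A (bigOat_id S P)).
by apply: near_eq_bigOat; apply: nearW => Q; rewrite subrK.
Qed.

Let Phi_near : \forall Q \near within S (nbhs P), [/\ has_gap N (gradE E Q),
  grassmann N (Phi N E Q) & gradE E Q *m Phi N E Q = Phi N E Q *m gradE E Q].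
Proof.
have [nu nu0 hnu] := aufbau_perturb N0 aufbau.
apply: filterS (bigOat_small nu0 W_bigO) => Q WQ.
have [gap exQ hQ] := hnu _ (trmx_gradE _ _) WQ.
by have [gQ cQ _] := hQ _ (xgetPex 0 exQ); split.
Qed.

Let D_bigO : bigOat S P D.
Proof.
have [nu nu0 hnu] := aufbau_perturb N0 aufbau.
have [K K0 WK] := W_bigO; exists (nu^-1 * K); first by rewrite mulr_gt0 // invr_gt0.
apply: filterS2 (bigOat_small nu0 W_bigO) WK => Q WQ WKQ.
have [_ exQ hQ] := hnu _ (trmx_gradE _ _) WQ.
have [_ _ DW] := hQ _ (xgetPex 0 exQ).
by rewrite -mulrA ler_pdivlMl // (le_trans DW).
Qed.

Let normal_littleo : littleoat S P (fun Q => (Q - P) - PiP P (Q - P)).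
Proof.
have XX := littleoat_mul (bigOat_id S P) (bigOat_id S P).
have := littleoatB XX (littleoatZ 2 (littleoat_linear (mulmx P)
  (littleoat_linear (mulmxr P) XX))).
apply: near_eq_littleoat; apply: filterS (near_mem S P) => Q [_ [QQ _]] /=.
by rewrite projB_normal.
Qed.

Let response_littleo : littleoat S P
  (fun Q => omega P H (PiP P (D Q)) + Kop E P (PiP P (Q - P))).
Proof.
have DW := littleoatB (littleoat_mul D_bigO W_bigO) (littleoat_mul W_bigO D_bigO).
(* Three errors: the Taylor remainder of the gradient, the normal part of [Q - P] inside the
   Hessian, and the commutator of [D] with [W], a product of two first order terms. *)
have := littleoatB (littleoatB (littleoatZ (-1) (littleoat_linear (PiP P) W_littleo))
  (littleoat_linear (PiP P) (littleoat_linear A normal_littleo)))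
  (littleoatB (littleoat_linear (mulmx P) DW) (littleoat_linear (mulmxr P) DW)).
apply: near_eq_littleoat; apply: filterS Phi_near => Q [_ [Phis _] comm] /=.
rewrite (omega_response Ps PP HP (W := W Q) Phis); last by rewrite /W addrC subrK.
rewrite -/(D Q) /Kop PiP_idem // -[hessE E P]/(A : _ -> _).
rewrite (linearB (PiP P) (W Q) (A (Q - P))) (linearB A (Q - P) (PiP P (Q - P))).
rewrite (linearB (PiP P) (A (Q - P)) (A (PiP P (Q - P)))) /=.
move: (PiP P (W Q)) (PiP P (A (Q - P))) (PiP P (A (PiP P (Q - P)))) (D Q *m W Q - W Q *m D Q).
move=> a b c d.
by mx_linear.
Qed.

Let y Q := PiP P (D Q) + Omega_inv E P (Kop E P (PiP P (Q - P))).

(** Applying [omega] to [y] gives the residual of the response equation. Coercivity on the tangent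
    vector [y], with Cauchy-Schwarz, then bounds [y] by that residual divided by [c]. *)
Let y_littleo : littleoat S P y.
Proof.
have [c c0 om_ge] := omega_ge N0 gP aufbau delta0 retr.
move=> e e0; have := response_littleo (mulr_gt0 c0 e0).
apply: filterS3 Phi_near (near_mem S P) => Q [_ [Phis _] _] [Qs _].
have Xs : (Q - P)^T = Q - P by rewrite linearB /= Ps Qs.
have Ds : (D Q)^T = D Q by rewrite linearB /= Ps Phis.
have [TZ omZ] := Omega_invP N0 gP aufbau delta0 retr
  (tangent_Khess E2 gP (tangent_tr (tangent_PiP Ps PP Xs))).
have Ty : tangent P (y Q) by apply: (tangentD PP) TZ; exact: tangent_PiP.
have <- : omega P H (y Q) = omega P H (PiP P (D Q)) + Kop E P (PiP P (Q - P)).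
  by rewrite -KhessE -omZ -linearD.
move=> hy; have [->|y0] := eqVneq (fnorm (y Q)) 0; first by rewrite mulr_ge0 // ltW.
have ypos : 0 < fnorm (y Q) by rewrite lt_def y0 fnorm_ge0.
rewrite -(ler_pM2l ypos) -(ler_pM2l c0) -expr2 fnorm_sqr.
apply: (le_trans (om_ge _ Ty)); apply: (le_trans (ler_norm _)).
apply: (le_trans (ler_ip _ _)); rewrite mulrCA ler_pM2l // mulrA; exact: hy.
Qed.

Variable beta : R.
Definition scf_step Q := Rt (Q + beta *: PiP Q (Phi N E Q - Q)).
Let V Q := beta *: PiP Q (Phi N E Q - Q).
Let Z Q := D Q - (Q - P).
(** The correction for projecting at [Q] instead of [P]; each term is a product of [Q - P] and
    [Z Q], hence of second order. *)
Let s Q := (Q - P) *m Z Q + Z Q *m (Q - P) - 2 *: ((Q - P) *m Z Q *m P +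
  P *m (Z Q *m (Q - P)) + (Q - P) *m Z Q *m (Q - P)).

Let Z_bigO : bigOat S P Z. Proof. exact/bigOatB/bigOat_id. Qed.

Let s_littleo : littleoat S P s.
Proof.
have XZ := littleoat_mul (bigOat_id S P) Z_bigO.
have ZX := littleoat_mul Z_bigO (bigOat_id S P).
apply: littleoatB; first exact: littleoatD.
apply: littleoatZ; apply: littleoatD; last first.
  exact/littleoat_mul/bigOat_id/littleoat_bigOat.
apply: littleoatD; first exact: (littleoat_linear (mulmxr P)).
exact: (littleoat_linear (mulmx P)).
Qed.

Let VE Q : V Q = beta *: (PiP P (Z Q) + s Q).
Proof.
have ZE : Phi N E Q - Q = Z Q by rewrite /Z /D; mx_linear.
rewrite /V ZE; congr (beta *: _); transitivity (PiP (P + (Q - P)) (Z Q)).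
  by rewrite (addrC P) subrK.
exact: PiP_shift.
Qed.

Let V_bigO : bigOat S P V.
Proof.
have := bigOatZ beta (bigOatD (bigOat_linear (PiP P) Z_bigO) (littleoat_bigOat s_littleo)).
by apply: near_eq_bigOat; apply: nearW => Q; rewrite VE.
Qed.

Let step_near : \forall Q \near within S (nbhs P),
  grassmann N (scf_step Q) /\ fnorm (scf_step Q - (Q + V Q)) <= C * fnorm (V Q) ^+ 2.
Proof.
apply: filterS3 Phi_near (near_mem S P) (bigOat_small delta0 V_bigO).
move=> Q [_ [Phis _] _] gQ Vd; have [Qs [QQ _]] := gQ.
have Zs : (Phi N E Q - Q)^T = Phi N E Q - Q by rewrite linearB /= Phis Qs.
have TV : tangent Q (V Q) by apply: (tangentZ QQ); exact: tangent_PiP.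
by have := retr gQ (tangent_tr TV) Vd; rewrite (PiP_id QQ TV).
Qed.

Let retr_littleo : littleoat S P (fun Q => scf_step Q - (Q + V Q)).
Proof.
have [K K0 VK] := V_bigO.
have C0 : 0 < (`|C| + 1) * K by rewrite mulr_gt0 // ltr_wpDl.
apply: (@littleoat_le _ _ _ _ _ (fun Q => fnorm (V Q)) _ C0); last first.
  by move=> e e0; exact: bigOat_small V_bigO.
apply: filterS2 step_near VK => Q [_ h] VKQ; apply: (le_trans h).
have V0 := fnorm_ge0 (V Q).
apply: (@le_trans _ _ ((`|C| + 1) * fnorm (V Q) ^+ 2)).
  by rewrite ler_wpM2r ?sqr_ge0 // (le_trans (ler_norm _)) // lerDl.
rewrite expr2 -!mulrA ler_pM2l ?ltr_wpDl //.
by have := ler_wpM2l V0 VKQ; lra.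
Qed.

Lemma scf_step_expand :
  (\forall Q \near within S (nbhs P), has_gap N (gradE E Q) /\ grassmann N (scf_step Q)) /\
  littleoat S P (fun Q => scf_step Q - P -
    (PiP P (Q - P) - beta *: Jscf E P (PiP P (Q - P)))).
Proof.
split; first by apply: filterS2 Phi_near step_near => Q [gap _ _] [].
(* The errors are those of the retraction, of the normal part of [Q - P], and [beta] times those of
   the linear response and of the moved projection. *)
have := littleoatD (littleoatD retr_littleo normal_littleo)
  (littleoatZ beta (littleoatD y_littleo s_littleo)).
apply: near_eq_littleoat; apply: nearW => Q; rewrite VE /y /Jscf /Z (linearB (PiP P) (D Q) (Q - P)) /=.
move: (scf_step Q) (PiP P (D Q)) (PiP P (Q - P)) (Omega_inv _ _ _) (s Q) => a b c d f.
by mx_linear.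
Qed.

End OneStep.

(** * Convergence *)

Section AdaptedNorm.
Context {R : realType} {n : nat}.
Variables P H : 'M[R]_n.
Variable c : R.
Hypothesis Ps : P^T = P.
Hypothesis PP : P *m P = P.
Hypothesis Hs : H^T = H.
Hypothesis HP : H *m P = P *m H.
Hypothesis c0 : 0 < c.
Hypothesis om_ge : forall X, tangent P X -> c * ip X X <= ip X (omega P H X).
Implicit Types X Y : 'M[R]_n.

(* The norm in which the linearised iteration contracts tangent vectors, extended to
   the normal directions, in which the iteration is quadratically small. *)
Definition scf_norm X : R :=
  Num.sqrt (ip (PiP P X) (omega P H (PiP P X))) + fnorm (X - PiP P X).

Lemma scf_norm_ge0 X : 0 <= scf_norm X.
Proof. by rewrite addr_ge0 ?sqrtr_ge0 ?fnorm_ge0. Qed.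

Lemma scf_norm_tangent X : tangent P X -> scf_norm X = Num.sqrt (ip X (omega P H X)).
Proof. by move=> TX; rewrite /scf_norm PiP_id // subrr fnorm0 addr0. Qed.

Lemma scf_normD X Y : X^T = X -> Y^T = Y -> scf_norm (X + Y) <= scf_norm X + scf_norm Y.
Proof.
move=> Xs Ys; have PD : PiP P (X + Y) = PiP P X + PiP P Y := linearD (PiP P) X Y.
have TX := tangent_PiP Ps PP Xs; have TY := tangent_PiP Ps PP Ys.
rewrite /scf_norm PD; move: TX TY; move: (PiP P X) (PiP P Y) => x y TX TY.
have : fnorm (X + Y - (x + y)) <= fnorm (X - x) + fnorm (Y - y).
  by rewrite (_ : _ - _ = (X - x) + (Y - y)) ?fnormD // opprD addrACA.
suff : Num.sqrt (ip (x + y) (omega P H (x + y))) <=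
    Num.sqrt (ip x (omega P H x)) + Num.sqrt (ip y (omega P H y)) by lra.
apply: (@psd_minkowski _ _ (tangent P) (fun X Y => ip X (omega P H Y))) => //.
- by move=> a u v; exact: tangent_linear.
- by move=> a u v w; rewrite ipDl ipZl.
- by move=> u v _ _; exact: omega_sym.
- by move=> u Tu; rewrite (le_trans _ (om_ge Tu)) // mulr_ge0 ?ip_ge0 // ltW.
Qed.

Lemma scf_norm_le : exists2 C, 0 < C & forall X, scf_norm X <= C * fnorm X.
Proof.
have [G G0 omG] := linear_fnorm_bound (omega P H).
have [D D0 piD] := linear_fnorm_bound (PiP P).
exists (Num.sqrt G * D + (1 + D)) => [|X].
  by rewrite addr_gt0 ?addr_gt0 ?mulr_gt0 ?sqrtr_gt0.
rewrite /scf_norm mulrDl; apply: lerD.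
  apply: (@le_trans _ _ (Num.sqrt G * fnorm (PiP P X))).
    rewrite -(ger0_norm (fnorm_ge0 (PiP P X))) -sqrtr_sqr -sqrtrM ?(ltW G0) //.
    rewrite ler_sqrt ?mulr_ge0 ?sqr_ge0 ?(ltW G0) //.
    apply: (le_trans (ler_norm _)); apply: (le_trans (ler_ip _ _)).
    by rewrite expr2 mulrCA ler_wpM2l ?omG.
  by rewrite -mulrA ler_wpM2l ?sqrtr_ge0 ?piD.
by rewrite mulrDl mul1r (le_trans (fnormB _ _)) // lerD ?piD.
Qed.

Lemma fnorm_le_scf_norm : exists2 C, 0 < C &
  forall X, X^T = X -> fnorm X <= C * scf_norm X.
Proof.
have sc : 0 < Num.sqrt c^-1 by rewrite sqrtr_gt0 invr_gt0.
exists (Num.sqrt c^-1 + 1) => [|X Xs]; first by rewrite addr_gt0.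
rewrite -{1}(subrK (PiP P X) X) (le_trans (fnormD _ _)) // /scf_norm.
have TX := tangent_PiP Ps PP Xs.
have : fnorm (PiP P X) <= Num.sqrt c^-1 * Num.sqrt (ip (PiP P X) (omega P H (PiP P X))).
  rewrite -sqrtrM ?invr_ge0 ?(ltW c0) // ler_sqrt; last first.
    by rewrite mulr_ge0 ?invr_ge0 ?(ltW c0) // (le_trans _ (om_ge TX)) // mulr_ge0 ?ip_ge0 // ltW.
  by rewrite ler_pdivlMl // om_ge.
set q := Num.sqrt (ip _ _); have q0 : 0 <= q by exact: sqrtr_ge0.
by have := mulr_ge0 (ltW sc) (fnorm_ge0 (X - PiP P X)); lra.
Qed.

End AdaptedNorm.

Theorem theorem3p3 (R : realType) (Nb N : nat)
  (E : 'M[R]_Nb -> R) (Rt : 'M[R]_Nb -> 'M[R]_Nb) (Ps : 'M[R]_Nb) :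
  (0 < N)%N -> (N <= Nb)%N ->
  C2 E ->
  grassmann N Ps ->
  (exists eta : R, 0 < eta /\ exists delta : R, 0 < delta /\
     forall P : 'M[R]_Nb, grassmann N P -> frob (P - Ps) < delta ->
       E Ps + eta * frob (P - Ps) ^+ 2 <= E P) ->
  C2 Rt ->
  (forall X : 'M[R]_Nb, symmH X -> symmH (Rt X)) ->
  (exists delta C : R, 0 < delta /\ 0 < C /\
     forall P X : 'M[R]_Nb, grassmann N P -> symmH X -> frob X < delta ->
       grassmann N (Rt (P + X)) /\
       frob (Rt (P + X) - (P + PiP P X)) <= C * frob X ^+ 2) ->
  aufbau_proj N (gradE E Ps) Ps ->
  exists beta0 : R, 0 < beta0 /\
  forall beta : R, 0 < beta -> beta < beta0 ->
    let rho := specrad_on (tangent Ps) (fun X => X - beta *: Jscf E Ps X) in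
    rho < 1 /\
    exists delta : R, 0 < delta /\
      (forall P0 : 'M[R]_Nb, grassmann N P0 -> frob (P0 - Ps) < delta ->
         forall k, grassmann N (scf_iter N E Rt beta P0 k) /\
                   has_gap N (gradE E (scf_iter N E Rt beta P0 k))) /\
      (forall theta : R, 0 < theta -> exists C : R, 0 < C /\
         forall P0 : 'M[R]_Nb, grassmann N P0 -> frob (P0 - Ps) < delta ->
           forall k, frob (scf_iter N E Rt beta P0 k - Ps)
                     <= C * (rho + theta) ^+ k * frob (P0 - Ps)).
Proof.
move=> N0 _ E2 gP [eta [eta0 [d [d0 minE]]]] _ _ [delta [C [delta0 [_ retr]]]] aufbau.
set H := gradE E Ps.
have Pss : Ps^T = Ps by case: gP.
have PP : Ps *m Ps = Ps by case: gP => _ [].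
have Hs : H^T = H by exact: trmx_gradE.
have HP : H *m Ps = Ps *m H by exact: aufbau_comm aufbau.
have [c c0 om_ge] := omega_ge N0 gP aufbau delta0 retr.
have Jspec X : tangent Ps X -> tangent Ps (Jscf E Ps X) /\
    omega Ps H (Jscf E Ps X) = omega Ps H X + Khess E Ps X.
  move=> TX; have [TZ omZ] := Omega_invP N0 gP aufbau delta0 retr
    (tangent_Khess E2 gP (tangent_tr TX)).
  by split; [exact: tangentD|rewrite (linearD (omega Ps H)) /= omZ].
have [beta0 beta00 hbeta] := @specrad_contraction _ _ (tangent Ps) (omega Ps H) (Khess E Ps)
  (Jscf E Ps) c eta (fun a x y => @tangent_linear _ _ _ PP a x y) (tangent_closed Pss PP) (tangent_neq0 N0 gP aufbau)
  (fun x y _ _ => omega_sym Pss Hs HP x y) (Khess_sym E2 gP) c0 om_ge eta0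
  (hessian_ge E2 gP aufbau delta0 retr eta0 d0 minE)
  (fun x Tx => (Jspec x Tx).1) (fun x Tx => (Jspec x Tx).2).
exists beta0; split=> // beta betapos /(hbeta _ betapos); set rho := specrad_on _ _.
move=> [rho0 rho1 contr]; split=> //.
have [near_gap expand] := scf_step_expand N0 E2 gP aufbau delta0 retr beta.
pose a Q := scf_norm Ps H (Q - Ps).
have [C1 C10 aC1] := scf_norm_le Ps H.
have [C2 C20 aC2] := fnorm_le_scf_norm Pss PP c0 om_ge.
have sub_tr Q : grassmann N Q -> (Q - Ps)^T = Q - Ps.
  by move=> [Qs _]; rewrite linearB /= Pss Qs.
have step e : 0 < e -> exists2 d, 0 < d & forall Q, grassmann N Q -> a Q < d ->
    [/\ has_gap N (gradE E Q), grassmann N (scf_step N E Rt beta Q)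
      & a (scf_step N E Rt beta Q) <= (rho + e) * a Q].
  (* The expansion error is a Frobenius norm: [C1] converts it to the adapted norm, [C2] bounds |Q -
     Ps| by that norm. *)
  move=> e0; have e'0 : 0 < e / (C1 * C2) by rewrite divr_gt0 // mulr_gt0.
  have /near_fnormP[d1 d10 hd1] : \forall Q \near within (grassmann N) (nbhs Ps),
      [/\ has_gap N (gradE E Q), grassmann N (scf_step N E Rt beta Q) &
       fnorm (scf_step N E Rt beta Q - Ps - (PiP Ps (Q - Ps) -
         beta *: Jscf E Ps (PiP Ps (Q - Ps)))) <= e / (C1 * C2) * fnorm (Q - Ps)].
    by apply: filterS2 near_gap (expand _ e'0) => Q [].
  exists (d1 / C2) => [|Q gQ]; first by rewrite divr_gt0.
  rewrite ltr_pdivlMr // mulrC => aQ; have Xs := sub_tr Q gQ.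
  have [gap gS err] := hd1 Q gQ (le_lt_trans (aC2 _ Xs) aQ); split=> //.
  have TX := tangent_PiP Pss PP Xs; have [TJ _] := Jspec _ TX.
  have contrL := contr _ TX; have Ys := sub_tr _ gS.
  have TL := tangentB PP TX (tangentZ PP beta TJ).
  rewrite {1}/a; move: contrL TL err Ys.
  move: (scf_step N E Rt beta Q - Ps) (PiP Ps (Q - Ps) - _) => Y L contrL TL err Ys.
  (* The new error [Y] is split into its linear prediction [L], tangent and contracted by [rho], and
     the small remainder [Y - L]. *)
  rewrite -(subrK L Y) addrC (le_trans (scf_normD Pss PP Hs HP c0 om_ge _ _)) //.
  - exact: tangent_tr TL.
  - by rewrite linearB /= Ys (tangent_tr TL).
  rewrite mulrDl; apply: lerD.
    rewrite scf_norm_tangent // -(ger0_norm (ltW rho0)) -sqrtr_sqr.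
    apply: (@le_trans _ _ (Num.sqrt (rho ^+ 2) *
      Num.sqrt (ip (PiP Ps (Q - Ps)) (omega Ps H (PiP Ps (Q - Ps)))))).
      by rewrite -sqrtrM ?sqr_ge0 // ler_sqrt // mulr_ge0 ?sqr_ge0 //
        (le_trans _ (om_ge _ TX)) // mulr_ge0 ?ip_ge0 // ltW.
    (* Only the tangential summand of [a Q] is needed to dominate [L]. *)
    by rewrite ler_wpM2l ?sqrtr_ge0 // lerDl.
  rewrite (le_trans (aC1 _)) // (le_trans (ler_wpM2l (ltW C10) err)) //.
  rewrite -{2}(divfK (lt0r_neq0 (mulr_gt0 C10 C20)) e).
  have := ler_wpM2l (ltW (mulr_gt0 C10 e'0)) (aC2 _ Xs).
  by move: (e / _) => e'; rewrite -/(a Q) /a; lra.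
have [d' d'0 [inv rate]] := asymptotic_rate rho0 rho1 (fun Q => scf_norm_ge0 Ps H (Q - Ps)) step.
have iterE Q k : scf_iter N E Rt beta Q k = iter k (scf_step N E Rt beta) Q.
  by elim: k => //= k ->.
have aQ Q : frob (Q - Ps) < d' / C1 -> a Q < d'.
  by rewrite ltr_pdivlMr // mulrC; apply: le_lt_trans; exact: aC1.
exists (d' / C1); split; first by rewrite divr_gt0.
split=> [Q gQ /aQ aQd k|theta theta0]; first by rewrite iterE; exact: inv.
(* The factors [C1] and [C2] pass between the Frobenius and the adapted norm at the start and at the
   end of the orbit. *)
have [K K0 hK] := rate _ theta0; exists (C2 * K * C1); split; first by rewrite !mulr_gt0.
move=> Q gQ /aQ aQd k; rewrite iterE.
have [gk _] := inv Q gQ aQd k.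
apply: (le_trans (aC2 _ (sub_tr _ gk))); rewrite -!mulrA ler_pM2l //.
apply: (le_trans (hK Q gQ aQd k)); rewrite -mulrA ler_pM2l // mulrCA.
by rewrite ler_wpM2l ?exprn_ge0 ?(ltW (addr_gt0 rho0 theta0)) // aC1.
Qed.
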